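(* Let $\mathcal{S}$ be a finite set of lattice polytopes in $\mathbb{R}^n$. If $\mathcal{S}$ is a positive basis, then $\mathbb{N}[\mathcal{S}]$ has unique and local factorization.
   Context: Tropical semiring: $a\odot b=a+b$, $a\oplus b=\max(a,b)$. A tropical polynomial is $f(x)=\max_{a\in A}(c_a+a\cdot x)$ with $A\subset\mathbb{Z}^n$ finite, $c_a\in\mathbb{R}$; $\mathrm{Newt}(f)=\mathrm{conv}(A)$. The regular subdivision $\Delta_f$ of $\mathrm{Newt}(f)$ is the projection to $\mathrm{Newt}(f)$ of the lower faces of $\mathrm{conv}\{(a,-c_a):a\in A\}$. Two tropical polynomials are regarded as equal if they differ by $a+v\cdot x$ for some $a\in\mathbb{R}$, $v\in\mathbb{Z}^n$ (equivalently, they define the same tropical hypersurface as weighted polyhedral complexes). Tropical product $f\odot g$ is the pointwise sum. A unit is a tropical polynomial $f$ whose $\Delta_f$ is the trivial subdivision of $\mathrm{Newt}(f)$. For polytopes $P,Q$: $P\equiv Q$ means $P=v+Q$ for some $v\in\mathbb{Z}^n$; $Q\le P$ means $Q+S=P$ for some polytope $S$; the signed Minkowski difference is $P-Q=\{x: x+Q\subseteq P\}$. An $\mathcal{S}$-unit is a unit $f$ with $\mathrm{Newt}(f)\equiv S$ for some $S\in\mathcal{S}$. $\mathbb{N}[\mathcal{S}]$ is the set of tropical polynomials equal to a tropical product of $\mathcal{S}$-units. $\mathbb{N}[\mathcal{S}]$ has unique factorization if each $f\in\mathbb{N}[\mathcal{S}]$ has a unique (up to order) factorization as a product of $\mathcal{S}$-units;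 it has local factorization if every tropical polynomial $f$ such that every cell of $\Delta_f$ lies in $\mathbb{N}\mathcal{S}$ belongs to $\mathbb{N}[\mathcal{S}]$, where $\mathbb{N}\mathcal{S}=\{$lattice polytopes $F: F\equiv\sum_{S\in\mathcal{S}}y_SS,\ y_S\in\mathbb{N}\}$. Faces: $\mathrm{face}_v(P)$ is the set of maximizers of $x\mapsto v\cdot x$ on $P$; a proper face of $P$ is a face that is neither $P$ nor a vertex. $H$-matrix: for a lattice polytope $P$ of dimension $k\ge1$, $H(P)\in\mathbb{Z}^{r\times n}$ is the matrix whose rows are the primitive outer normal vectors to the $(k-1)$-dimensional faces of $P$. A lattice polytope $Q$ is $H(P)$-representable if $Q\le c\cdot P$ for some integer $c>0$; then $b^{H}(Q)\in\mathbb{Z}^r$ is the coordinatewise minimal $b$ with $Q=\{x:H(P)x\le b\}$. The $H$-matrix $H$ of $\mathcal{S}$ is $H(\sum_{S\in\mathcal{S}}S)$; $B(\mathcal{S})=\{b^H(S):S\in\mathcal{S}\}$. $\mathcal{S}$ is a basis if the vectors of $B(\mathcal{S})$ form a basis (over $\mathbb{Z}$) of the group $\mathbb{Z}B(\mathcal{S})$ they generate. $\mathcal{S}$ is hierarchical if for each $S\in\mathcal{S}$ every proper face of $S$ lies in $\mathbb{N}\mathcal{S}$ (for hierarchical $\mathcal{S}$ the rows of $H$ are closed under negation). An orientation is a map $\tau$ from the rows of $H$ to $\{\pm1\}$ with $\tau(-v)=-\tau(v)$; $\mathcal{S}$ is positive with orientation $\tau$ if for every row $v$ with $\tau(v)=+1$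 and every $S\in\mathcal{S}$, $\mathrm{face}_{-v}(S)$ is not a proper face of $S$. A positive basis is a hierarchical basis that is positive with respect to some orientation.
   Formalization: ''Basis'' is read up to lattice translation: distinct classes of b^H(S) modulo HZ^n are Z-independent (with raw vectors {[0,2],[1,2]} is a counterexample); if the sum of S is not full-dimensional, normals and {Hx ≤ b} are taken within its direction space. *)

(* Defs.v *)
From HB Require Import structures.
From mathcomp Require Import all_boot all_order all_algebra finmap.
From mathcomp Require Import boolp classical_sets reals.

Set Implicit Arguments.
Unset Strict Implicit.
Unset Printing Implicit Defensive.

Import Order.TTheory GRing.Theory Num.Theory.

Local Open Scope classical_set_scope.
Local Open Scope ring_scope.

Section Polytopes.
Variable R : realType.

Definition intv n (a : 'rV[int]_n) : 'rV[R]_n := map_mx intr a.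

Definition dot n (u x : 'rV[R]_n) : R := \sum_(i < n) u 0 i * x 0 i.

Definition conv n (A : set 'rV[R]_n) : set 'rV[R]_n :=
  [set x | exists k (w : 'I_k -> R) (p : 'I_k -> 'rV[R]_n),
    [/\ forall i, 0 <= w i, \sum_(i < k) w i = 1, forall i, A (p i)
      & x = \sum_(i < k) w i *: p i]].

Definition lattice_polytope n (P : set 'rV[R]_n) : Prop :=
  exists2 A : {fset 'rV[int]_n},
    A != fset0 & P = conv [set intv a | a in [set` A]].

Definition face n (v : 'rV[R]_n) (P : set 'rV[R]_n) : set 'rV[R]_n :=
  [set x | P x /\ forall y, P y -> dot v y <= dot v x].

Definition is_face n (P F : set 'rV[R]_n) : Prop := exists v, F = face v P.

Definition proper_face n (P F : set 'rV[R]_n) : Prop :=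
  [/\ is_face P F, F <> P & forall x, F <> [set x]].

Definition translate n (v : 'rV[int]_n) (P : set 'rV[R]_n) : set 'rV[R]_n :=
  [set intv v + x | x in P].

Definition equivt n (P Q : set 'rV[R]_n) : Prop := exists v, P = translate v Q.

Definition minkowski n (P Q : set 'rV[R]_n) : set 'rV[R]_n :=
  [set x + y | x in P & y in Q].

Definition dilate n (k : nat) (P : set 'rV[R]_n) : set 'rV[R]_n :=
  [set k%:R *: x | x in P].

Definition minksum n (S : {fset set 'rV[R]_n}) (y : set 'rV[R]_n -> nat) :
    set 'rV[R]_n :=
  \big[@minkowski n/[set 0]]_(P <- S) dilate (y P) P.

Definition NS n (S : {fset set 'rV[R]_n}) : set (set 'rV[R]_n) :=
  [set F | lattice_polytope F /\ exists y, equivt F (minksum S y)].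

Definition hierarchical n (S : {fset set 'rV[R]_n}) : Prop :=
  forall P F, P \in S -> proper_face P F -> NS S F.

(* The linear span of P - P, i.e. the direction of the affine hull of P; the
   default value of xget is never used, see dirspaceP. *)
Definition dirspace n (P : set 'rV[R]_n) : {vspace 'rV[R]_n} :=
  xget 0%VS [set U | forall W : {vspace 'rV[R]_n},
    (U <= W)%VS <-> forall x y, P x -> P y -> x - y \in W].

Definition dimp n (P : set 'rV[R]_n) : nat := \dim (dirspace P).

Lemma dirspaceP n (P : set 'rV[R]_n) (W : {vspace 'rV[R]_n}) :
  (dirspace P <= W)%VS <-> forall x y, P x -> P y -> x - y \in W.
Proof.
pose D (W : {vspace 'rV[R]_n}) := forall x y, P x -> P y -> x - y \in W.
have exd : exists d, `[< exists2 U, D U & \dim U = d >].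
  exists (\dim (fullv : {vspace 'rV[R]_n})); apply/asboolP.
  by exists fullv => // x y _ _; rewrite memvf.
suff exU : exists U, [set U | forall W, (U <= W)%VS <-> D W] U.
  exact: (xgetPex 0%VS exU W).
case: (ex_minnP exd) => _ /asboolP[U DU <-] minU.
exists U => W'; split=> [/subvP sUW x y Px Py | DW]; first exact/sUW/DU.
have : (\dim U <= \dim (U :&: W'))%N.
  apply: minU; apply/asboolP; exists (U :&: W')%VS => // x y Px Py.
  by rewrite memv_cap DU ?DW.
move=> leU; have := capvSr U W'.
by have /eqP -> : (U :&: W' == U)%VS by rewrite eqEdim capvSl.
Qed.

(* If P is not full-dimensional, the outer normals of a facet of P are unique
   only up to the orthogonal complement of dirspace P: the representative
   lying in dirspace P is taken (no condition if P is full-dimensional). *)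
Definition facet_normal n (P : set 'rV[R]_n) (v : 'rV[int]_n) : Prop :=
  [/\ \big[gcdz/0]_(i < n) v 0 i = 1,
      intv v \in dirspace P
    & (dimp (face (intv v) P)).+1 = dimp P].

Definition is_Hmatrix n r (H : 'M[int]_(r, n)) (P : set 'rV[R]_n) : Prop :=
  injective (fun i => row i H) /\
  forall v, facet_normal P v <-> exists i, row i H = v.

(* {x : H x <= b}, within the translate of dirspace P through Q (all of R^n if
   P is full-dimensional). *)
Definition Hpolyhedron n r (H : 'M[int]_(r, n)) (P Q : set 'rV[R]_n)
    (b : 'rV[int]_r) : set 'rV[R]_n :=
  [set x | (exists2 q, Q q & x - q \in dirspace P) /\
           forall i, dot (intv (row i H)) x <= (b 0 i)%:~R].

(* b = b^H(Q), for H = H(P) and Q H-representable. *)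
Definition is_bvec n r (H : 'M[int]_(r, n)) (P Q : set 'rV[R]_n)
    (b : 'rV[int]_r) : Prop :=
  Q = Hpolyhedron H P Q b /\
  forall b', Q = Hpolyhedron H P Q b' -> forall i, b 0 i <= b' 0 i.

Definition total n (S : {fset set 'rV[R]_n}) : set 'rV[R]_n :=
  minksum S (fun=> 1%N).

Definition Bvecs n r (H : 'M[int]_(r, n)) (S : {fset set 'rV[R]_n}) :
    set 'rV[int]_r :=
  [set b | exists2 Q, Q \in S & is_bvec H (total S) Q b].

End Polytopes.

(* The classes modulo the subgroup T of the elements of B form a Z-basis of the
   subgroup that they generate, i.e. distinct classes are Z-independent. *)
Definition zbasis_mod (V : zmodType) (T B : set V) : Prop :=
  forall (s : seq V) (y : V -> int),
    uniq s -> (forall b, b \in s -> B b) ->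
    {in s &, forall b c, T (b - c) -> b = c} ->
    T (\sum_(b <- s) b *~ y b) -> forall b, b \in s -> y b = 0.

Section Factorization.
Variable R : realType.

(* b^H(u + Q) = b^H(Q) + H u. *)
Definition translations n r (H : 'M[int]_(r, n)) : set 'rV[int]_r :=
  [set u *m H^T | u in [set: 'rV[int]_n]].

(* Polytopes are taken up to lattice translation, as tropical polynomials are
   taken up to a + v.x, hence the vectors b^H(S) modulo H Z^n. With the raw
   vectors of Z^r, {[0,2], [1,2]} in R^1 would be a basis (b^H = (2,0), (2,-1)),
   although max(0,2x) is an S-unit for [0,2] and the square of the S-unit
   max(0,x) for [1,2]. *)
Definition is_basis n r (H : 'M[int]_(r, n)) (S : {fset set 'rV[R]_n}) : Prop :=
  zbasis_mod (translations H) (Bvecs H S).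

Definition orientation n r (H : 'M[int]_(r, n)) (tau : 'rV[int]_n -> int) :
    Prop :=
  forall i, (tau (row i H) = 1 \/ tau (row i H) = -1) /\
            tau (- row i H) = - tau (row i H).

Definition positive n r (H : 'M[int]_(r, n)) (tau : 'rV[int]_n -> int)
    (S : {fset set 'rV[R]_n}) : Prop :=
  forall i P, tau (row i H) = 1 -> P \in S ->
    ~ proper_face P (face (- intv R (row i H)) P).

Definition positive_basis n (S : {fset set 'rV[R]_n}) : Prop :=
  exists r (H : 'M[int]_(r, n)),
    [/\ is_Hmatrix H (total S), hierarchical S, is_basis H S
      & exists2 tau, orientation H tau & positive H tau S].

Record tpoly n := TPoly {
  supp : {fset 'rV[int]_n};
  supp_neq0 : supp != fset0;
  coef : 'rV[int]_n -> R }.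

Definition term n (f : tpoly n) (x : 'rV[R]_n) (a : 'rV[int]_n) : R :=
  coef f a + dot (intv R a) x.

(* supp f is nonempty: the unit of the iterated max is one of its terms. *)
Definition teval n (f : tpoly n) (x : 'rV[R]_n) : R :=
  \big[Num.max/term f x (head 0 (supp f))]_(a <- supp f) term f x a.

Definition teq n (f g : 'rV[R]_n -> R) : Prop :=
  exists (c : R) (v : 'rV[int]_n), forall x, f x = c + dot (intv R v) x + g x.

Definition Newt n (f : tpoly n) : set 'rV[R]_n :=
  conv [set intv R a | a in [set` supp f]].

Definition lifted n (f : tpoly n) : set 'rV[R]_(n + 1) :=
  conv [set row_mx (intv R a) (- coef f a)%:M | a in [set` supp f]].

Definition Delta n (f : tpoly n) : set (set 'rV[R]_n) :=
  [set F | exists2 w : 'rV[R]_(n + 1),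
    w 0 (rshift n ord0) < 0 & F = [set lsubmx z | z in face w (lifted f)]].

Definition is_unit n (f : tpoly n) : Prop :=
  Delta f = [set F | is_face (Newt f) F].

Definition is_Sunit n (S : {fset set 'rV[R]_n}) (f : tpoly n) : Prop :=
  is_unit f /\ exists2 P, P \in S & equivt (Newt f) P.

(* The empty product (k = 0) is the tropical one. *)
Definition factorization n (S : {fset set 'rV[R]_n}) (f : tpoly n) k
    (u : 'I_k -> tpoly n) : Prop :=
  (forall i, is_Sunit S (u i)) /\
  teq (teval f) (fun x => \sum_(i < k) teval (u i) x).

Definition NSpoly n (S : {fset set 'rV[R]_n}) (f : tpoly n) : Prop :=
  exists k (u : 'I_k -> tpoly n), factorization S f u.

Definition unique_factorization n (S : {fset set 'rV[R]_n}) : Prop :=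
  forall f k l (u : 'I_k -> tpoly n) (w : 'I_l -> tpoly n),
    factorization S f u -> factorization S f w ->
    exists2 e : 'I_k -> 'I_l,
      bijective e & forall i, teq (teval (u i)) (teval (w (e i))).

Definition local_factorization n (S : {fset set 'rV[R]_n}) : Prop :=
  forall f : tpoly n, (forall F, Delta f F -> NS S F) -> NSpoly S f.

End Factorization.

(* Main.v *)
From HB Require Import structures.
Require Import Defs.
From mathcomp Require Import all_boot all_order all_algebra finmap.
From mathcomp Require Import boolp classical_sets reals.
From mathcomp Require Import perm ring lra zify.

(* A product of units is a sum of translated support functions h_i(x - p), where
   h_i is the support function of the i-th polytope of S (up to translation).
   The local cell of such a sum, or of any f whose cells lie in NS, at a point x
   is a vector y(x) of multiplicities, well defined because S is a basis.  Moving
   from x a little in direction w replaces every polytope by its face in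
   direction w, hence acts on y by a linear map with nonnegative coefficients
   (hierarchy).  Order the polytopes by inclusion of their lineality spaces D_i.

   Uniqueness: the number of units of type i with apex in x + D_i is read off
   from y_i(x), once the types of strictly smaller D_j are known.

   Local factorization: subtract units one at a time.  Let delta >= 0 be the
   multiplicities that remain and delta_i(x0) > 0 with D_i minimal; then delta_i
   is constant on x0 + D_i.  Any w is, up to D_i, a nonnegative combination of
   facet normals v of the total polytope whose faces contain face_w; if face_w(S_i)
   is not a vertex, those outside D_i cut out proper faces of S_i, hence are
   positive by the orientation axiom, and positivity makes delta_j monotone along
   such v whenever v lies in D_j.  Walking from x0 to x0 + w along them gives
   delta(x0 + w) >= y(face_w(S_i)), so a unit of type i with apex x0 can be
   subtracted. *)

Set Implicit Arguments.
Unset Strict Implicit.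
Unset Printing Implicit Defensive.

Import Order.TTheory GRing.Theory Num.Theory.

Local Open Scope classical_set_scope.
Local Open Scope ring_scope.

(** * The scalar product on row vectors and its restriction to lattice vectors *)

Section Dot.
Variables (R : realType) (n : nat).
Implicit Types u v x y : 'rV[R]_n.

Lemma dotC u v : dot u v = dot v u.
Proof. by apply: eq_bigr => i _; rewrite mulrC. Qed.

Lemma dotDr u x y : dot u (x + y) = dot u x + dot u y.
Proof. by rewrite /dot -big_split; apply: eq_bigr => i _; rewrite mxE mulrDr. Qed.

Lemma dotZr a u x : dot u (a *: x) = a * dot u x.
Proof. by rewrite /dot mulr_sumr; apply: eq_bigr => i _; rewrite mxE mulrCA. Qed.

Lemma dotDl u v x : dot (u + v) x = dot u x + dot v x.
Proof. by rewrite dotC dotDr !(dotC x). Qed.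

Lemma dotZl a u x : dot (a *: u) x = a * dot u x.
Proof. by rewrite dotC dotZr dotC. Qed.

Lemma dotNr u x : dot u (- x) = - dot u x.
Proof. by rewrite -scaleN1r dotZr mulN1r. Qed.

Lemma dotNl u x : dot (- u) x = - dot u x.
Proof. by rewrite dotC dotNr dotC. Qed.

Lemma dotBr u x y : dot u (x - y) = dot u x - dot u y.
Proof. by rewrite dotDr dotNr. Qed.

Lemma dotBl u v x : dot (u - v) x = dot u x - dot v x.
Proof. by rewrite dotDl dotNl. Qed.

Lemma dot0r u : dot u 0 = 0.
Proof. by rewrite -(scale0r 0) dotZr mul0r. Qed.

Lemma dot0l u : dot 0 u = 0.
Proof. by rewrite dotC dot0r. Qed.

Lemma dot_sumr I (r : seq I) (P : pred I) (F : I -> 'rV[R]_n) u :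
  dot u (\sum_(i <- r | P i) F i) = \sum_(i <- r | P i) dot u (F i).
Proof. by apply: (big_morph (dot u)) => [x y|]; rewrite ?dotDr ?dot0r. Qed.

Lemma dot_suml I (r : seq I) (P : pred I) (F : I -> 'rV[R]_n) u :
  dot (\sum_(i <- r | P i) F i) u = \sum_(i <- r | P i) dot (F i) u.
Proof. by rewrite dotC dot_sumr; apply: eq_bigr => i _; rewrite dotC. Qed.

Definition dotE := (dotDr, dotDl, dotNr, dotNl, dotZr, dotZl, dot0r, dot0l).

Lemma dot_ge0 u : 0 <= dot u u.
Proof. by apply: sumr_ge0 => i _; rewrite -expr2 sqr_ge0. Qed.

Lemma dot_eq0 u : (dot u u == 0) = (u == 0).
Proof.
apply/idP/eqP => [|->]; last by rewrite dot0r.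
rewrite psumr_eq0 => [/allP h|i _]; last by rewrite -expr2 sqr_ge0.
apply/rowP => i; rewrite mxE; apply/eqP.
by have := h i (mem_index_enum i); rewrite -expr2 sqrf_eq0.
Qed.

Lemma dot_gt0 u : u != 0 -> 0 < dot u u.
Proof. by move=> u0; rewrite lt_def dot_eq0 u0 dot_ge0. Qed.

Lemma dot_all0 u : (forall z, dot z u = 0) -> u = 0.
Proof. by move=> h; apply/eqP; rewrite -dot_eq0 h. Qed.

Lemma intvD (a b : 'rV[int]_n) : intv R (a + b) = intv R a + intv R b.
Proof. by apply/rowP => i; rewrite !mxE intrD. Qed.

Lemma intvN (a : 'rV[int]_n) : intv R (- a) = - intv R a.
Proof. by apply/rowP => i; rewrite !mxE intrN. Qed.

Lemma intvB (a b : 'rV[int]_n) : intv R (a - b) = intv R a - intv R b.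
Proof. by rewrite intvD intvN. Qed.

Lemma intv0 : intv R (0 : 'rV[int]_n) = 0.
Proof. by apply/rowP => i; rewrite !mxE. Qed.

Lemma intvZ (k : int) (a : 'rV[int]_n) : intv R (k *: a) = k%:~R *: intv R a.
Proof. by apply/rowP => i; rewrite !mxE intrM. Qed.

Lemma intv_inj : injective (@intv R n).
Proof.
by move=> a b /rowP e; apply/rowP => i; have := e i; rewrite !mxE => /intr_inj.
Qed.

Lemma intv_sum I (r : seq I) (P : pred I) (F : I -> 'rV[int]_n) :
  intv R (\sum_(i <- r | P i) F i) = \sum_(i <- r | P i) intv R (F i).
Proof. by apply: (big_morph _ intvD intv0). Qed.

Lemma dot_intv (a b : 'rV[int]_n) :
  dot (intv R a) (intv R b) = (\sum_(i < n) a 0 i * b 0 i)%:~R.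
Proof. by rewrite rmorph_sum; apply: eq_bigr => i _; rewrite !mxE rmorphM. Qed.

End Dot.

(** * Properties valid for all small positive reals, and induction along a half-line *)

Section Near0.
Variable R : realType.
Implicit Types P Q : R -> Prop.

Definition near0 P := exists2 e, 0 < e & forall t, 0 < t < e -> P t.

Lemma near0T P : (forall t, 0 < t -> P t) -> near0 P.
Proof. by move=> h; exists 1 => // t /andP[t0 _]; apply: h. Qed.

Lemma near0_and P Q : near0 P -> near0 Q -> near0 (fun t => P t /\ Q t).
Proof.
move=> [e e0 h] [d d0 k]; exists (Num.min e d); first by rewrite lt_min e0.
by move=> t; rewrite lt_min => /and3P[t0 te td]; split; [apply: h|apply: k]; apply/andP.
Qed.

Lemma near0S P Q : (forall t, 0 < t -> P t -> Q t) -> near0 P -> near0 Q.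
Proof.
move=> PQ [e e0 h]; exists e => // t te; apply: PQ; last exact: h.
by case/andP: te.
Qed.

Lemma near0_all (T : eqType) (s : seq T) (P : T -> R -> Prop) :
  (forall b, b \in s -> near0 (P b)) ->
  near0 (fun t => forall b, b \in s -> P b t).
Proof.
elim: s => [|a s IH] h; first exact: near0T.
have h1 : near0 (P a) by apply: h; rewrite mem_head.
have h2 : near0 (fun t => forall b, b \in s -> P b t).
  by apply: IH => b bs; apply: h; rewrite inE bs orbT.
apply: near0S (near0_and h1 h2) => t _ [Pa Ps] b.
by rewrite inE => /predU1P[->|/Ps].
Qed.

Lemma near0_ex P : near0 P -> exists2 t, 0 < t & P t.
Proof.
move=> [e e0 h]; have e2 : 0 < e / 2 by lra.
by exists (e / 2) => //; apply: h; rewrite e2; lra.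
Qed.

Lemma near0_gap (g s : R) : 0 < g -> near0 (fun t => t * s < g).
Proof.
move=> g0; have [s0|s0] := leP s 0.
  by apply: near0T => t t0; apply: le_lt_trans g0; rewrite pmulr_rle0.
exists (g / s); first exact: divr_gt0.
by move=> t /andP[_]; rewrite ltr_pdivlMr.
Qed.

(** Real induction: let [c] be the supremum of the [t <= T] such that [P] holds on all of [0,t]. The
    left condition gives [P c], and if [c < T] the right condition would extend the interval beyond
    [c]. *)
Lemma real_ind P : P 0 ->
  (forall t, 0 <= t -> P t -> near0 (fun e => P (t + e))) ->
  (forall t, 0 < t -> near0 (fun e => P (t - e) -> P t)) ->
  forall t, 0 <= t -> P t.
Proof.
move=> P0 hr hl T T0.
pose E := [set t | 0 <= t <= T /\ forall s, 0 <= s <= t -> P s].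
have E0 : E 0.
  by split=> [|s]; rewrite ?lexx // -eq_le => /eqP <-.
have supE : has_sup E by split; [exists 0|exists T => t [/andP[]]].
pose c := sup E.
have c0 : 0 <= c by apply: sup_upper_bound.
have cT : c <= T by apply: ge_sup => [|t [/andP[]]] //; exists 0.
have Plt s : 0 <= s -> s < c -> P s.
  move=> s0 sc; have [t [_ h] st] := sup_gt (ex_intro _ 0 E0) sc.
  by apply: h; rewrite s0 ltW.
have Pc : P c.
  have [->//|cn0] := eqVneq c 0; have cp : 0 < c by rewrite lt_def cn0.
  have [e e0 he] := hl c cp.
  pose d := Num.min (e / 2) (c / 2).
  have d0 : 0 < d by rewrite lt_min; apply/andP; split; lra.
  have de : d < e by rewrite gt_min; apply/orP; left; lra.
  have dc : d <= c / 2 by rewrite ge_min lexx orbT.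
  by apply: (he d); rewrite ?d0 //; apply: Plt; lra.
have [Tc|cltT] := leP T c.
  by have -> : T = c by apply/eqP; rewrite eq_le Tc cT.
have [e e0 he] := hr c c0 Pc.
pose d := Num.min (e / 2) (T - c).
have d0 : 0 < d by rewrite lt_min; apply/andP; split; lra.
have de : d < e by rewrite gt_min; apply/orP; left; lra.
have dT : d <= T - c by rewrite ge_min lexx orbT.
suff : c + d <= c by rewrite gerDl leNgt d0.
apply: sup_upper_bound => //; split; first by apply/andP; split; lra.
move=> s /andP[s0 scd]; have [sc|cs|->//] := ltgtP s c; first exact: Plt.
have -> : s = c + (s - c) by lra.
by apply: he; apply/andP; split; lra.
Qed.

End Near0.

(** * Tropical polynomials and support functions, with their first-order expansions *)

Section Support.
Variables (R : realType) (n : nat).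
Implicit Types (c : 'rV[int]_n -> R) (A B : {fset 'rV[int]_n}).
Implicit Types (x w z : 'rV[R]_n) (a b : 'rV[int]_n).

Definition pterm c x a : R := c a + dot (intv R a) x.

Definition pmax c B x : R :=
  \big[Num.max/pterm c x (head 0 B)]_(a <- B) pterm c x a.

(** The points whose convex hull is the cell of the regular subdivision dual to [x], see
    [DeltaP]. *)
Definition pargmax c B x : {fset 'rV[int]_n} :=
  [fset a in B | pterm c x a == pmax c B x]%fset.

(** With zero coefficients, [pmax] is the support function of the convex hull of [B], and [pargmax]
    consists of the points of [B] on its face in direction [x]. *)
Definition supf B x := pmax (fun=> 0) B x.
Definition fmax B x := pargmax (fun=> 0) B x.

Lemma pmax_ub c B x a : a \in B -> pterm c x a <= pmax c B x.
Proof. by move=> aB; apply: le_bigmax_seq. Qed.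

Lemma pmax_ex c B x : B != fset0 -> exists2 a, a \in B & pmax c B x = pterm c x a.
Proof.
move=> /fset0Pn[a0 a0B].
have hs (s : seq 'rV[int]_n) : a0 \in s -> head 0 s \in s.
  by case: s => //= y s _; rewrite mem_head.
have hB : head 0 B \in B := hs _ a0B.
rewrite /pmax big_seq; elim/big_ind: _ => [|y z [a aB ->] [b bB ->]|a aB].
- by exists (head 0 B).
- by rewrite maxEle; case: ifP => _; [exists b|exists a].
- by exists a.
Qed.

Lemma pmaxP c B x a : a \in B ->
  (forall b, b \in B -> pterm c x b <= pterm c x a) -> pmax c B x = pterm c x a.
Proof.
move=> aB h; have [|b bB e] := pmax_ex c x (_ : B != fset0).
  by apply/fset0Pn; exists a.
by apply/eqP; rewrite eq_le pmax_ub // e h.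
Qed.

Lemma mem_pargmax c B x a :
  (a \in pargmax c B x) = (a \in B) && (pterm c x a == pmax c B x).
Proof. by rewrite !inE. Qed.

Lemma pargmax_sub c B x a : a \in pargmax c B x -> a \in B.
Proof. by rewrite mem_pargmax => /andP[]. Qed.

Lemma pargmax_neq0 c B x : B != fset0 -> pargmax c B x != fset0.
Proof.
move=> /(pmax_ex c x)[a aB e].
by apply/fset0Pn; exists a; rewrite mem_pargmax aB e eqxx.
Qed.

Lemma pargmaxP c B x a : reflect
  (a \in B /\ forall b, b \in B -> pterm c x b <= pterm c x a)
  (a \in pargmax c B x).
Proof.
rewrite mem_pargmax; apply: (iffP andP) => [[aB /eqP->]|[aB h]].
  by split=> // b; apply: pmax_ub.
by rewrite (pmaxP aB h).
Qed.

Lemma pterm0 x a : pterm (fun=> 0) x a = dot (intv R a) x.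
Proof. by rewrite /pterm add0r. Qed.

Lemma supf_ub B x a : a \in B -> dot (intv R a) x <= supf B x.
Proof. by move=> /(pmax_ub (fun=> 0) x); rewrite pterm0. Qed.

Lemma supf_ex B x : B != fset0 ->
  exists2 a, a \in B & supf B x = dot (intv R a) x.
Proof. by move=> /(pmax_ex (fun=> 0) x)[a]; rewrite pterm0; exists a. Qed.

Lemma mem_fmax B x a :
  (a \in fmax B x) = (a \in B) && (dot (intv R a) x == supf B x).
Proof. by rewrite mem_pargmax pterm0. Qed.

Lemma fmax_sub B x a : a \in fmax B x -> a \in B.
Proof. exact: pargmax_sub. Qed.

Lemma fmax_neq0 B x : B != fset0 -> fmax B x != fset0.
Proof. exact: pargmax_neq0. Qed.

Lemma fmaxP B x a : reflect
  (a \in B /\ forall b, b \in B -> dot (intv R b) x <= dot (intv R a) x)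
  (a \in fmax B x).
Proof.
by apply: (iffP (pargmaxP _ _ _ _)) => -[aB h]; split=> // b /h; rewrite !pterm0.
Qed.

Lemma supf_fmax B x a : a \in fmax B x -> supf B x = dot (intv R a) x.
Proof. by rewrite mem_fmax => /andP[_ /eqP]. Qed.

Lemma pmax_pargmax c B x a : a \in pargmax c B x -> pmax c B x = pterm c x a.
Proof. by rewrite mem_pargmax => /andP[_ /eqP]. Qed.

Lemma pterm_move c x w (t : R) a :
  pterm c (x + t *: w) a = pterm c x a + t * dot (intv R a) w.
Proof. by rewrite /pterm !dotE addrA. Qed.

(** Terms that are not maximal at [x] stay below by a positive gap, which survives a small move; the
    terms maximal at [x] are then compared by their slopes along [w] alone. *)
Lemma pmax_expand c B x w : B != fset0 -> near0 (fun t =>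
  pargmax c B (x + t *: w) = fmax (pargmax c B x) w /\
  pmax c B (x + t *: w) = pmax c B x + t * supf (pargmax c B x) w).
Proof.
move=> B0; have /fset0Pn[m mM] := fmax_neq0 w (pargmax_neq0 c x B0).
have mA := fmax_sub mM; have mB := pargmax_sub mA.
have : near0 (fun t => forall b, b \in (B : seq _) -> b \notin pargmax c B x ->
    t * (dot (intv R b) w - dot (intv R m) w) < pterm c x m - pterm c x b).
  apply: near0_all => b bB; have [|bA] := boolP (b \in pargmax c B x).
    by move=> _; apply: near0T.
  have g0 : 0 < pterm c x m - pterm c x b; last first.
    apply: near0S (near0_gap (dot (intv R b) w - dot (intv R m) w) g0).
    by move=> t _ lt_t _.
  move: bA; rewrite mem_pargmax bB -(pmax_pargmax mA) subr_gt0 lt_def eq_sym.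
  by move->; apply: pmax_ub.
apply: near0S => t t0 h.
have key b : b \in B -> (pterm c (x + t *: w) b <= pterm c (x + t *: w) m) *
    ((pterm c (x + t *: w) b == pterm c (x + t *: w) m) = (b \in fmax (pargmax c B x) w)).
  move=> bB; rewrite !pterm_move; have [bA|bA] := boolP (b \in pargmax c B x).
    have tn0 : t != 0 by rewrite gt_eqF.
    rewrite -(pmax_pargmax mA) -(pmax_pargmax bA) lerD2l ler_pM2l //.
    split; first by rewrite -(supf_fmax mM) supf_ub.
    by rewrite mem_fmax bA (supf_fmax mM) (inj_eq (addrI _)) (inj_eq (mulfI tn0)).
  have lt1 : pterm c x b + t * dot (intv R b) w < pterm c x m + t * dot (intv R m) w.
    by have := h b bB bA; lra.
  by rewrite ltW // lt_eqF // mem_fmax (negbTE bA).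
have e : pmax c B (x + t *: w) = pterm c (x + t *: w) m by apply: pmaxP => // b /key[].
split; last by rewrite e pterm_move (supf_fmax mM) (pmax_pargmax mA).
apply/fsetP => b; rewrite mem_pargmax e; have [bB|bB] := boolP (b \in B).
  by rewrite (key b bB).2.
by rewrite mem_fmax mem_pargmax (negbTE bB).
Qed.

Lemma supf_expand B x w : B != fset0 -> near0 (fun t =>
  fmax B (x + t *: w) = fmax (fmax B x) w /\
  supf B (x + t *: w) = supf B x + t * supf (fmax B x) w).
Proof. exact: pmax_expand. Qed.

(** These [z] form the lineality space of the normal fan of the convex hull of [B]; for [B = A i] it
    is the space D_i. *)
Definition flat B z := forall a b, a \in B -> b \in B ->
  dot (intv R a) z = dot (intv R b) z.

Lemma flatS B B' z : (forall a, a \in B -> a \in B') -> flat B' z -> flat B z.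
Proof. by move=> s h a b /s aB /s; apply: h. Qed.

Lemma flat_fmax B z : flat (fmax B z) z.
Proof. by move=> a b aM bM; rewrite -(supf_fmax aM) -(supf_fmax bM). Qed.

Lemma flat_fmaxE B z : flat B z -> fmax B z = B.
Proof.
move=> f; apply/fsetP => a; apply/idP/idP => [/fmax_sub//|aB].
by apply/fmaxP; split=> // b bB; rewrite (f a b).
Qed.

Lemma fmax_flat B z : fmax B z = B -> flat B z.
Proof. by move=> e; rewrite -e; apply: flat_fmax. Qed.

Lemma flatD B z z' : flat B z -> flat B z' -> flat B (z + z').
Proof. by move=> h h' a b aB bB; rewrite !dotE (h a b) // (h' a b). Qed.

Lemma flatZ B (k : R) z : flat B z -> flat B (k *: z).
Proof. by move=> h a b aB bB; rewrite !dotE (h a b). Qed.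

Lemma flatN B z : flat B z -> flat B (- z).
Proof. by move=> h a b aB bB; rewrite !dotE (h a b). Qed.

Lemma flat0 B : flat B 0.
Proof. by move=> a b _ _; rewrite !dotE. Qed.

Lemma width_ge0 B z : B != fset0 -> 0 <= supf B z + supf B (- z).
Proof.
move=> /fset0Pn[a aB]; have := supf_ub z aB; have := supf_ub (- z) aB.
by rewrite dotE; lra.
Qed.

Lemma flatE B z : B != fset0 -> flat B z <-> supf B z + supf B (- z) = 0.
Proof.
move=> B0; split=> [f|e].
  have [a aB ->] := supf_ex z B0; have [b bB ->] := supf_ex (- z) B0.
  by rewrite (f a b) // dotE; lra.
move=> a b aB bB; have := supf_ub z aB; have := supf_ub z bB.
by have := supf_ub (- z) bB; have := supf_ub (- z) aB; rewrite !dotE; lra.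
Qed.

Lemma supf_flatD B z d a : a \in B -> flat B d ->
  supf B (z + d) = supf B z + dot (intv R a) d.
Proof.
move=> aB f; have [|b bB e] := supf_ex z (_ : B != fset0); first by apply/fset0Pn; exists a.
rewrite e -(f b a) // -dotDr; rewrite -pterm0; apply: pmaxP => // b' b'B.
by rewrite !pterm0 !dotDr (f b' b) // lerD2r -e supf_ub.
Qed.

Lemma fmax_flatD B z d : flat B d -> fmax B (z + d) = fmax B z.
Proof.
move=> f; apply/fsetP => a; apply/fmaxP/fmaxP => -[aB h]; split=> // b bB; move: (h b bB);
  by rewrite !dotDr (f b a) // lerD2r.
Qed.

Lemma supf0 B : B != fset0 -> supf B 0 = 0.
Proof. by move=> B0; have [a _ ->] := supf_ex 0 B0; rewrite dotE. Qed.

(** At the common maximizer [a] both scalar products are maximal at once, so a point maximizes the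
    sum exactly if it maximizes each of them. *)
Lemma fmaxD B z z' a : a \in fmax B z -> a \in fmax B z' ->
  fmax B (z + z') = fmax (fmax B z) z'.
Proof.
move=> az az'; have aB := fmax_sub az.
apply/fsetP => b; apply/fmaxP/fmaxP => -[bB h].
  have := h a aB; rewrite !dotDr.
  have := supf_ub z bB; have := supf_ub z' bB.
  rewrite (supf_fmax az) (supf_fmax az') => h1 h2 h3; split.
    by rewrite mem_fmax bB (supf_fmax az); apply/eqP; lra.
  move=> d /fmax_sub dB; have := supf_ub z' dB; rewrite (supf_fmax az'); lra.
have := h a az; rewrite -(supf_fmax az') => h1; split; first exact: fmax_sub bB.
move=> d dB; rewrite !dotDr lerD // -?(supf_fmax bB) ?supf_ub //.
by rewrite (le_trans _ h1) ?supf_ub.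
Qed.

Lemma fmaxZ B (k : R) z : 0 < k -> fmax B (k *: z) = fmax B z.
Proof.
move=> k0; apply/fsetP => a; apply/fmaxP/fmaxP => -[aB h]; split=> // b bB; move: (h b bB);
  by rewrite !dotZr ler_pM2l.
Qed.

Lemma supf1 a z : supf [fset a]%fset z = dot (intv R a) z.
Proof.
rewrite -pterm0; apply: pmaxP => [|b]; first by rewrite inE.
by rewrite inE => /eqP->.
Qed.

(** * Support functions that are combinations of others: faces and lineality spaces *)

Section Combination.
Variables (T : eqType) (s : seq T) (F : T -> {fset 'rV[int]_n}) (k : T -> R).
Variables (B : {fset 'rV[int]_n}) (u : 'rV[R]_n).
Hypotheses (F0 : forall p, p \in s -> F p != fset0) (B0 : B != fset0).
Hypothesis supfB : forall z, supf B z = dot u z + \sum_(p <- s) k p * supf (F p) z.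

(* Compare the directional derivatives at [w] of both sides of [supfB]. *)
Lemma supf_comb_fmax w z :
  supf (fmax B w) z = dot u z + \sum_(p <- s) k p * supf (fmax (F p) w) z.
Proof.
have e : near0 (fun t => supf B (w + t *: z) = supf B w + t * supf (fmax B w) z /\
    forall p, p \in s ->
      supf (F p) (w + t *: z) = supf (F p) w + t * supf (fmax (F p) w) z).
  apply: near0_and; first by apply: near0S (supf_expand w z B0) => t _ [].
  by apply: near0_all => p ps; apply: near0S (supf_expand w z (F0 ps)) => t _ [].
have [t t0 [eB eA]] := near0_ex e.
have tn0 : t != 0 by rewrite gt_eqF.
apply: (mulfI tn0); move: eB; rewrite !supfB dotDr dotZr.
have -> : \sum_(p <- s) k p * supf (F p) (w + t *: z) =
    \sum_(p <- s) k p * supf (F p) w + t * \sum_(p <- s) k p * supf (fmax (F p) w) z.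
  rewrite mulr_sumr -big_split; apply: eq_big_seq => p ps.
  by rewrite eA // mulrDr mulrCA.
by lra.
Qed.

(** The width of [B] along [z] is the combination of the widths of the [F p], the linear term
    cancelling. All summands are nonnegative, so the sum vanishes only if each summand does. *)
Lemma supf_comb_flat z : (forall p, p \in s -> 0 <= k p) ->
  flat B z <-> forall p, p \in s -> k p != 0 -> flat (F p) z.
Proof.
move=> k0.
have eW : supf B z + supf B (- z) =
    \sum_(p <- s) k p * (supf (F p) z + supf (F p) (- z)).
  under [RHS]eq_bigr do rewrite mulrDr.
  by rewrite big_split /= !supfB dotNr; lra.
have ge p : p \in s -> 0 <= k p * (supf (F p) z + supf (F p) (- z)).
  by move=> ps; rewrite mulr_ge0 ?k0 ?width_ge0 ?F0.
split=> [/(flatE _ B0)|fl].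
  rewrite eW => /eqP; rewrite big_seq psumr_eq0 // => /allP sum0 p ps kp.
  apply/flatE; first exact: F0.
  by have := sum0 p ps; rewrite ps /= mulf_eq0 (negbTE kp) => /eqP.
apply/flatE => //; rewrite eW big_seq; apply: big1 => p ps.
have [->|kp] := eqVneq (k p) 0; first by rewrite mul0r.
by have /flatE -> := fl p ps kp; rewrite ?F0 ?mulr0.
Qed.

End Combination.

End Support.

(** * Finitely generated cones and the lemma of Farkas *)

Section Farkas.
Variables (R : realType) (n : nat).
Implicit Types (s : seq 'rV[R]_n) (a b w z : 'rV[R]_n).

(** Coefficients are peeled off one at a time, which fits induction on the list of generators;
    [coneP] recovers the usual sum. *)
Fixpoint cone s b : Prop :=
  if s is a :: s' then exists2 c : R, 0 <= c & cone s' (b - c *: a) else b = 0.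

(* Projecting along [a] onto the hyperplane orthogonal to a [w] separating [b]
   from the cone over [s] reduces the cone over [a :: s] to one over [s]. *)
Lemma farkas s b :
  (forall w, (forall a, a \in s -> dot w a <= 0) -> dot w b <= 0) -> cone s b.
Proof.
move: {2}(size s) (erefl (size s)) => k; elim: k s b => [|k IH] [|a s] b //=.
  by move=> _ h; apply/eqP; rewrite -dot_eq0 eq_le dot_ge0 h.
move=> [sz] h; have [cb|ncb] := pselect (cone s b).
  by exists 0; rewrite ?scale0r ?subr0.
have [w ws wb] : exists2 w, (forall a, a \in s -> dot w a <= 0) & 0 < dot w b.
  apply: contrapT => nw; apply/ncb/IH => // w ws; rewrite leNgt; apply/negP => wb.
  by apply: nw; exists w.
have wa : 0 < dot w a.
  rewrite ltNge; apply/negP => wa; move: wb; rewrite ltNge h // => d.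
  by rewrite inE => /predU1P[->|/ws].
have wan0 : dot w a != 0 by rewrite gt_eqF.
pose pr d := d - (dot w d / dot w a) *: a.
have cpr : cone (map pr s) (pr b).
  apply: IH; first by rewrite size_map.
  move=> z zs; pose z' := z - (dot z a / dot w a) *: w.
  have ez d : dot z' d = dot z (pr d) by rewrite /z' /pr !dotE; field.
  rewrite -ez; apply: h => d; rewrite inE => /predU1P[->|ds].
    by rewrite /z' !dotE mulfVK // subrr.
  by rewrite ez; apply: zs; rewrite map_f.
(* Undoing the projection shifts everything into a multiple of [a]; its coefficient stays
   nonnegative because [dot w d <= 0] for the generators [d] in [s]. *)
have lift s' b' : {subset s' <= s} -> cone (map pr s') b' ->
    exists2 c, 0 <= c & cone s' (b' - c *: a).
  elim: s' b' => /= [b' _ ->|d s' IHs b' sub [k' k0 cs']].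
    by exists 0; rewrite ?scale0r ?subr0.
  have [|c c0 cc] := IHs _ _ cs'.
    by move=> x xs; apply: sub; rewrite inE xs orbT.
  have wd : dot w d <= 0 by apply/ws/sub; rewrite mem_head.
  exists (c - k' * (dot w d / dot w a)).
    by rewrite subr_ge0 (le_trans _ c0) // mulr_ge0_le0 // pmulr_lle0 ?invr_gt0.
  exists k' => //; congr cone: cc; rewrite /pr.
  by apply/rowP => i; rewrite !mxE; ring.
have [c c0 cc] := lift s _ (fun x => id) cpr.
exists (c + dot w b / dot w a).
  by rewrite addr_ge0 // divr_ge0 // ltW.
by congr cone: cc; rewrite /pr; apply/rowP => i; rewrite !mxE; ring.
Qed.

Lemma coneP s b : cone s b ->
  exists c : 'I_(size s) -> R, (forall i, 0 <= c i) /\ b = \sum_i c i *: s`_i.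
Proof.
elim: s b => [|a s IH] b /=; first by move=> ->; exists (fun=> 0); rewrite big_ord0.
move=> [k k0 /IH[c [c0 e]]].
exists (fun i => if unlift ord0 i is Some j then c j else k); split.
  by move=> i; case: unliftP => [j|] _.
rewrite big_ord_recl unlift_none /=; under eq_bigr do rewrite liftK.
by rewrite -e addrC subrK.
Qed.

End Farkas.

(** * Convex hulls, their faces and support functions, and Minkowski operations *)

Section Conv.
Variables (R : realType) (n : nat).
Implicit Types (A B : {fset 'rV[int]_n}) (P Q : set 'rV[R]_n).

Notation pts A := [set intv R a | a in [set` A]].

Lemma sub_conv P x : P x -> conv P x.
Proof.
move=> Px; exists 1%N, (fun=> 1), (fun=> x); split=> //.
- by rewrite big_ord1.
- by rewrite big_ord1 scale1r.
Qed.

Lemma conv_le P (w x : 'rV[R]_n) (M : R) :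
  (forall y, P y -> dot w y <= M) -> conv P x -> dot w x <= M.
Proof.
move=> h [k [c [p [c0 c1 Pp ->]]]]; rewrite dot_sumr -[M]mul1r -c1 mulr_suml.
by apply: ler_sum => i _; rewrite dotZr ler_wpM2l // h.
Qed.

Lemma conv_mono P Q : P `<=` Q -> conv P `<=` conv Q.
Proof.
by move=> PQ x [k [c [p [c0 c1 Pp ->]]]]; exists k, c, p; split=> // i; apply/PQ/Pp.
Qed.

(** A convex combination reaching the maximum of [v] puts positive weight only on points where [v]
    is maximal. *)
Lemma conv_face P (v m0 : 'rV[R]_n) : P m0 ->
  (forall y, P y -> dot v y <= dot v m0) ->
  face v (conv P) = conv (P `&` [set y | dot v y = dot v m0]).
Proof.
move=> Pm0 h; apply/seteqP; split=> x.
  move=> [[k [c [p [c0 c1 Pp ->]]]] hx].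
  (* Points of weight zero need not lie on the face and are replaced by [m0]. *)
  exists k, c, (fun i => if c i == 0 then m0 else p i); split=> //; last first.
    by apply: eq_bigr => i _; case: eqP => // ->; rewrite !scale0r.
  move=> i; case: eqP => // /eqP ci0; split; first exact: Pp.
  have : \sum_(i < k) c i * (dot v m0 - dot v (p i)) <= 0.
    under eq_bigr do rewrite mulrBr.
    rewrite sumrB -mulr_suml c1 mul1r subr_le0.
    have := hx _ (sub_conv Pm0); rewrite dot_sumr.
    by under eq_bigr do rewrite dotZr.
  have ge i' : 0 <= c i' * (dot v m0 - dot v (p i')).
    by rewrite mulr_ge0 // subr_ge0 h.
  move=> le0; have : \sum_(i < k) c i * (dot v m0 - dot v (p i)) == 0.
    by rewrite eq_le le0 sumr_ge0.
  rewrite psumr_eq0 // => /allP /(_ i (mem_index_enum i)) /=.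
  by rewrite mulf_eq0 (negbTE ci0) /= subr_eq0 => /eqP.
move=> cx; split; first by apply: conv_mono cx => y [].
have ex : dot v m0 <= dot v x.
  rewrite -lerN2 -!dotNl; apply: conv_le cx => y [_ /= e].
  by rewrite !dotNl e.
move=> y cy; apply: le_trans ex; exact: conv_le cy.
Qed.

Lemma conv_image m (f : {linear 'rV[R]_m -> 'rV[R]_n}) (P : set 'rV[R]_m) :
  conv [set f x | x in P] = [set f x | x in conv P].
Proof.
apply/seteqP; split=> y.
  move=> [k [c [p [c0 c1 Pp ->]]]].
  have /choice[q hq] : forall i, exists x, P x /\ f x = p i.
    by move=> i; have [x Px e] := Pp i; exists x.
  exists (\sum_(i < k) c i *: q i).
    by exists k, c, q; split=> // i; case: (hq i).
  by rewrite linear_sum; apply: eq_bigr => i _; rewrite linearZ /=; case: (hq i) => _ ->.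
move=> [x [k [c [p [c0 c1 Pp ->]]]] <-].
exists k, c, (f \o p); split=> // [i|]; first by exists (p i).
by rewrite linear_sum; apply: eq_bigr => i _; rewrite linearZ.
Qed.

(** Appending a coordinate 1 turns the convex hull into a slice of a cone, to which [farkas]
    applies; the last coordinate then says that the weights sum to 1. *)
Lemma convP A (x : 'rV[R]_n) : A != fset0 ->
  conv (pts A) x <-> forall w, dot w x <= supf A w.
Proof.
move=> A0; split=> [cx w|h].
  by apply: conv_le cx => y [a aA <-]; rewrite dotC supf_ub.
pose ext (y : 'rV[R]_n) : 'rV[R]_(n + 1) := row_mx y 1%:M.
have dext w y : dot w (ext y) = dot (lsubmx w) y + rsubmx w 0 0.
  rewrite /dot big_split_ord /= big_ord1; congr (_ + _).
    by apply: eq_bigr => i _; rewrite row_mxEl mxE.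
  by rewrite row_mxEr !mxE mulr1.
pose s := [seq ext (intv R a) | a <- A].
have /coneP[c [c0 ec]] : cone s (ext x).
  apply: farkas => w hw; rewrite dext.
  have [a aA ea] := supf_ex (lsubmx w) A0.
  have := hw (ext (intv R a)) (map_f _ aA); rewrite dext; apply: le_trans.
  by rewrite lerD2r [X in _ <= X]dotC -ea h.
have sz : size s = size A by rewrite size_map.
have mems (i : 'I_(size s)) : exists2 a, a \in A & s`_i = ext (intv R a).
  have /mapP[a aA e] : s`_i \in s by rewrite mem_nth.
  by exists a.
have /choice[p hp] : forall i : 'I_(size s), exists a, a \in A /\ s`_i = ext (intv R a).
  by move=> i; have [a] := mems i; exists a.
exists (size s), c, (fun i => intv R (p i)); split=> //.
- move/(congr1 (fun z : 'rV[R]_(n + 1) => z 0 (rshift n 0))): ec.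
  rewrite row_mxEr mxE summxE eqxx mulr1n => ->.
  by apply: eq_bigr => i _; rewrite (hp i).2 mxE row_mxEr !mxE mulr1.
- by move=> i; exists (p i) => //; case: (hp i).
- move/(congr1 lsubmx): ec; rewrite row_mxKl => ->; rewrite linear_sum.
  by apply: eq_bigr => i _; rewrite (hp i).2 linearZ /= row_mxKl.
Qed.

Lemma conv_pts_face A (v : 'rV[R]_n) : A != fset0 ->
  face v (conv (pts A)) = conv (pts (fmax A v)).
Proof.
move=> A0; have /fset0Pn[m mM] := fmax_neq0 v A0; have mA := fmax_sub mM.
rewrite (conv_face (m0 := intv R m)).
- congr conv; apply/seteqP; split=> y.
    move=> [[a aA <-] /= e]; exists a => //=.
    by rewrite mem_fmax aA (supf_fmax mM) dotC e dotC eqxx.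
  move=> [a /= aM <-]; split; first by exists a => //; apply: fmax_sub aM.
  by rewrite /= dotC -(supf_fmax aM) (supf_fmax mM) dotC.
- by exists m.
- by move=> y [a aA <-]; rewrite dotC [X in _ <= X]dotC -(supf_fmax mM) supf_ub.
Qed.

(** The maximum is required to be attained, so [h] is determined by [P]. The relational form passes
    through sums, dilations and translations without exhibiting generating points. *)
Definition is_supf P (h : 'rV[R]_n -> R) : Prop := forall w,
  (forall x, P x -> dot w x <= h w) /\ exists2 x, P x & dot w x = h w.

Lemma is_supf_uniq P h h' : is_supf P h -> is_supf P h' -> h =1 h'.
Proof.
move=> hh hh' w; have [le1 [x Px ex]] := hh w; have [le2 [y Py ey]] := hh' w.
by apply/eqP; rewrite eq_le -{1}ex le2 // -ey le1.
Qed.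

Lemma is_supf_ext P h h' : h =1 h' -> is_supf P h -> is_supf P h'.
Proof. by move=> e hh w; rewrite -e. Qed.

Lemma is_supf_conv A : A != fset0 -> is_supf (conv (pts A)) (supf A).
Proof.
move=> A0 w; split=> [x /convP|]; first exact.
have [a aA ->] := supf_ex w A0; exists (intv R a); last by rewrite dotC.
by apply: sub_conv; exists a.
Qed.

Lemma is_supf_minkowski P Q h k : is_supf P h -> is_supf Q k ->
  is_supf (minkowski P Q) (fun w => h w + k w).
Proof.
move=> hP hQ w; have [le1 [x Px ex]] := hP w; have [le2 [y Py ey]] := hQ w.
split=> [_ [a Pa [b Qb <-]]|]; first by rewrite dotDr lerD ?le1 ?le2.
by exists (x + y); [exists x => //; exists y|rewrite dotDr ex ey].
Qed.

Lemma is_supf_dilate P h m : is_supf P h ->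
  is_supf (dilate m P) (fun w => m%:R * h w).
Proof.
move=> hP w; have [le1 [x Px ex]] := hP w.
split=> [_ [a Pa <-]|]; first by rewrite dotZr ler_wpM2l ?le1.
by exists (m%:R *: x); [exists x|rewrite dotZr ex].
Qed.

Lemma is_supf_translate P h v : is_supf P h ->
  is_supf (translate v P) (fun w => dot (intv R v) w + h w).
Proof.
move=> hP w; have [le1 [x Px ex]] := hP w.
split=> [_ [a Pa <-]|]; first by rewrite dotDr [dot w _]dotC lerD2l le1.
by exists (intv R v + x); [exists x|rewrite dotDr [dot w _]dotC ex].
Qed.

Lemma is_supf_minksum (S : {fset set 'rV[R]_n}) (y : set 'rV[R]_n -> nat)
    (h : set 'rV[R]_n -> 'rV[R]_n -> R) :
  (forall P, P \in S -> is_supf P (h P)) ->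
  is_supf (minksum S y) (fun w => \sum_(P <- S) (y P)%:R * h P w).
Proof.
move=> hs0; have {hs0}hs P : P \in enum_fset S -> is_supf P (h P) by apply: hs0.
rewrite /minksum; elim: (enum_fset S) hs => [|P s IH] hs.
  by move=> w; rewrite !big_nil; split=> [_ ->|]; [|exists 0]; rewrite ?dot0r.
rewrite big_cons; have := is_supf_minkowski (is_supf_dilate (y P) (hs P (mem_head _ _)))
  (IH (fun Q Qs => hs Q (mem_behead (s := P :: s) Qs))).
by apply: is_supf_ext => w; rewrite big_cons.
Qed.

(** The sums [a + b] generate: one inclusion is checked on support functions through [convP], the
    other by splitting every generator of a convex combination. *)
Lemma minkowski_lattice P Q :
  lattice_polytope P -> lattice_polytope Q -> lattice_polytope (minkowski P Q).
Proof.
move=> [A A0 ->] [B B0 ->].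
pose L := [seq (a + b)%R | a <- A, b <- B].
pose AB := [fset x | x in L]%fset.
have ABP c : (c \in AB) = (c \in L) by rewrite !inE.
have AB0 : AB != fset0.
  have [a aA] := fset0Pn _ A0; have [b bB] := fset0Pn _ B0.
  by apply/fset0Pn; exists (a + b); rewrite ABP; apply/allpairsP; exists (a, b).
exists AB => //; apply/seteqP; split=> x.
  move=> [y /(convP _ A0) hy [z /(convP _ B0) hz <-]]; apply/convP => // w.
  have [a aA ea] := supf_ex w A0; have [b bB eb] := supf_ex w B0.
  rewrite dotDr (le_trans (lerD (hy w) (hz w))) // ea eb -dotDl -intvD supf_ub //.
  by rewrite ABP; apply/allpairsP; exists (a, b).
move=> [k [c [p [c0 c1 Pp ->]]]].
have /choice[q hq] : forall i, exists ab : _ * _, [/\ ab.1 \in A, ab.2 \in B &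
    p i = intv R ab.1 + intv R ab.2].
  move=> i; have [d /=] := Pp i; rewrite ABP => /allpairsP[[a b] [aA bB ->]] <-.
  by exists (a, b); rewrite intvD.
exists (\sum_(i < k) c i *: intv R (q i).1).
  exists k, c, (fun i => intv R (q i).1); split=> // i.
  by exists (q i).1 => //; case: (hq i).
exists (\sum_(i < k) c i *: intv R (q i).2).
  exists k, c, (fun i => intv R (q i).2); split=> // i.
  by exists (q i).2 => //; case: (hq i).
by rewrite -big_split; apply: eq_bigr => i _; case: (hq i) => _ _ ->; rewrite scalerDr.
Qed.

Lemma dilate1 P : dilate 1 P = P.
Proof.
apply/seteqP; split=> [_ [x Px <-]|x Px]; first by rewrite scale1r.
by exists x => //; rewrite scale1r.
Qed.

Lemma total_lattice (S : {fset set 'rV[R]_n}) :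
  (forall P, P \in S -> lattice_polytope P) -> lattice_polytope (Defs.total S).
Proof.
move=> hs0; have {hs0}hs P : P \in enum_fset S -> lattice_polytope P by apply: hs0.
rewrite /Defs.total /minksum; elim: (enum_fset S) hs => [|P s IH] hs.
  rewrite big_nil; exists [fset 0]%fset; first by apply/fset0Pn; exists 0; rewrite inE.
  apply/seteqP; split=> x.
    move=> ->; apply: sub_conv; exists 0; rewrite /= ?inE ?intv0 //.
  move=> [k [c [p [c0 c1 Pp ->]]]]; apply: big1 => i _.
  by have [a /=] := Pp i; rewrite inE => /eqP -> <-; rewrite intv0 scaler0.
rewrite big_cons dilate1; apply: minkowski_lattice; first by apply: hs; rewrite mem_head.
by apply: IH => Q Qs; apply: hs; rewrite inE Qs orbT.
Qed.

End Conv.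

(** * Cells of the regular subdivision as sets of maximal terms *)

Section Subdivision.
Variables (R : realType) (n : nat).

Notation pts A := [set intv R a | a in [set` A]].

(** If [t] is minus the last coordinate of [w], then [w] takes on the lifted point of [a] the value
    [t] times the term of [a] at [x]. The lower face therefore lies over the terms maximal at
    [x]. *)
Lemma Delta_lift (f : tpoly R n) (w : 'rV[R]_(n + 1)) :
  w 0 (rshift n ord0) < 0 ->
  [set lsubmx z | z in face w (lifted f)] =
  conv (pts (pargmax (coef f) (supp f) ((- w 0 (rshift n ord0))^-1 *: lsubmx w))).
Proof.
move=> w0; set t := - w 0 (rshift n ord0); set x := t^-1 *: _.
have t0 : 0 < t by rewrite oppr_gt0.
have ew a : dot w (row_mx (intv R a) (- coef f a)%:M) = t * pterm (coef f) x a.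
  rewrite /pterm /x dotZr mulrDr mulVKf ?gt_eqF // [RHS]addrC.
  rewrite /dot big_split_ord /= big_ord1; congr (_ + _).
    by apply: eq_bigr => i _; rewrite row_mxEl mxE mulrC mxE.
  by rewrite row_mxEr !mxE mulr1n /t mulrN mulNr.
have /fset0Pn[m mM] := pargmax_neq0 (coef f) x (supp_neq0 f).
have mA := pargmax_sub mM.
rewrite /lifted (conv_face (m0 := row_mx (intv R m) (- coef f m)%:M)); first last.
- move=> y [a aA <-]; rewrite !ew ler_pM2l //.
  by move/pargmaxP: mM => [_]; apply.
- by exists m.
rewrite -conv_image; congr conv; apply/seteqP; split=> y.
  move=> [z [[a aA <-] /= e] <-]; rewrite row_mxKl; exists a => //=.
  move: e; rewrite !ew => /(mulfI (lt0r_neq0 t0)) e.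
  by rewrite mem_pargmax (aA : a \in supp f) e (pmax_pargmax mM) eqxx.
move=> [a /= aM <-]; exists (row_mx (intv R a) (- coef f a)%:M); last by rewrite row_mxKl.
split; first by exists a => //; apply: pargmax_sub aM.
by rewrite /= !ew -(pmax_pargmax aM) (pmax_pargmax mM).
Qed.

Lemma DeltaP (f : tpoly R n) F :
  Delta f F <-> exists x, F = conv (pts (pargmax (coef f) (supp f) x)).
Proof.
split=> [[w w0 ->]|[x ->]]; first by rewrite Delta_lift //; eexists.
have ew : (row_mx x (- 1)%:M : 'rV[R]_(n + 1)) 0 (rshift n ord0) = -1.
  by rewrite row_mxEr mxE.
exists (row_mx x (- 1)%:M); first by rewrite ew oppr_lt0.
by rewrite Delta_lift ew ?oppr_lt0 // opprK invr1 scale1r row_mxKl.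
Qed.

End Subdivision.

(** * Orthogonal projection and direction spaces of polytopes *)

Section Orthogonality.
Variables (R : realType) (n : nat).
Implicit Types (U : {vspace 'rV[R]_n}) (x y z : 'rV[R]_n).

(** Gram-Schmidt along a basis of [U]: [a - p] is the part of the new vector orthogonal to the span
    of the earlier ones, and the projection of [x] gains a multiple of it. *)
Lemma ortho_decomp U x :
  exists2 u, u \in U & forall z, z \in U -> dot z (x - u) = 0.
Proof.
have hU : U = <<vbasis U>>%VS by rewrite (span_basis (vbasisP U)).
rewrite hU; move: (vbasis U : seq _) => s {U hU}.
elim: s x => [|a s IH] x.
  by exists 0; rewrite ?mem0v // => z; rewrite span_nil memv0 => /eqP->; rewrite dot0l.
have [p ps hp] := IH a; have [u us hu] := IH x.
have sub z : z \in <<s>>%VS -> z \in <<a :: s>>%VS.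
  by move=> zs; rewrite span_cons; apply: subvP zs; apply: addvSr.
have aas : a \in <<a :: s>>%VS by rewrite memv_span ?mem_head.
have dec z : z \in <<a :: s>>%VS -> exists k r, r \in <<s>>%VS /\ z = k *: (a - p) + r.
  rewrite span_cons => /memv_addP[_ /vlineP[k ->] [r rs ->]].
  exists k, (k *: p + r); rewrite scalerBr addrA subrK; split=> //.
  by rewrite memvD // memvZ.
have [ap0|apn0] := eqVneq (a - p) 0.
  exists u; first exact: sub.
  by move=> z /dec[k [r [rs ->]]]; rewrite ap0 scaler0 add0r hu.
pose k := dot (a - p) (x - u) / dot (a - p) (a - p).
exists (u + k *: (a - p)).
  by apply: rpredD; [exact: sub|apply/rpredZ/rpredB => //; exact: sub].
move=> z /dec[l [r [rs ->]]]; rewrite opprD addrA; move: (hu r rs) (hp r rs).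
rewrite /k; move: (a - p) (x - u) apn0 => q y qn0 ry rq.
rewrite dotDl dotZl !dotBr !dotZr ry rq; field.
by rewrite dot_eq0.
Qed.

Definition dotfun x (z : 'rV[R]_n) : R^o := dot x z.

Lemma dotfun_linear x : linear (dotfun x).
Proof. by move=> k a b; rewrite /dotfun dotDr dotZr. Qed.

HB.instance Definition _ x := GRing.isLinear.Build R 'rV[R]_n R^o *:%R (dotfun x) (dotfun_linear x).

Definition dotker x : {vspace 'rV[R]_n} :=
  lker (linfun (dotfun x)).

Lemma mem_dotker x z : (z \in dotker x) = (dot x z == 0).
Proof. by rewrite memv_ker lfunE. Qed.

Lemma dim_dotker U x : x \in U -> x != 0 -> (\dim (U :&: dotker x)).+1 = \dim U.
Proof.
move=> xU x0; rewrite -(limg_ker_dim (linfun (dotfun x)) U).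
rewrite -addn1; congr addn; apply/esym/eqP; rewrite eqn_leq.
rewrite (leq_trans (dimvS (subvf _))) ?dimvf //= lt0n dimv_eq0.
apply/eqP => e0; have := memv_img (linfun (dotfun x)) xU.
rewrite e0 memv0 lfunE => /eqP; rewrite /= /dotfun => /eqP.
by rewrite dot_eq0 (negbTE x0).
Qed.

Lemma ortho_flat (A : {fset 'rV[int]_n}) x :
  (forall z, z \in dirspace (conv [set intv R a | a in [set` A]]) -> dot z x = 0) ->
  flat A x.
Proof.
move=> ox a b aA bA; apply/eqP; rewrite -subr_eq0 -dotBl; apply/eqP/ox.
have /dirspaceP := subvv (dirspace (conv [set intv R a | a in [set` A]])).
by apply; apply: sub_conv; [exists a|exists b].
Qed.

(** The direction space is the orthogonal complement of the lineality space: the part of [z]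
    orthogonal to [dirspace P] is flat, hence orthogonal to [z] and so to itself. *)
Lemma mem_dirspace (A : {fset 'rV[int]_n}) z : A != fset0 ->
  z \in dirspace (conv [set intv R a | a in [set` A]]) <->
  forall d, flat A d -> dot d z = 0.
Proof.
move=> A0; set P := conv _; split.
  move=> zU d fd.
  have /subvP/(_ z zU) : (dirspace P <= dotker d)%VS.
    apply/dirspaceP => x y /(convP _ A0) Px /(convP _ A0) Py.
    rewrite mem_dotker dotBr subr_eq0; apply/eqP.
    have /flatE e := fd; have := e A0; have := Px d; have := Px (- d).
    by have := Py d; have := Py (- d); rewrite !dotNl; lra.
  by rewrite mem_dotker => /eqP.
move=> h; have [u uU hu] := ortho_decomp (dirspace P) z.
have fz : flat A (z - u) by apply: ortho_flat.
have : z - u == 0 by rewrite -dot_eq0 dotBr h // [dot _ u]dotC hu ?subrr.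
by rewrite subr_eq0 => /eqP->.
Qed.

End Orthogonality.

(** * Integral vectors in rationally defined subspaces *)

Section Integrality.
Variables (R : realType) (n : nat).

Notation pts A := [set intv R a | a in [set` A]].

Lemma big_gcdz_dvd I (r : seq I) (F : I -> int) (i : I) : List.In i r ->
  (\big[gcdz/0]_(i <- r) F i %| F i)%Z.
Proof.
elim: r => //= j r IH [->|/IH h]; rewrite big_cons; first exact: dvdz_gcdl.
exact: dvdz_trans (dvdz_gcdr _ _) h.
Qed.

Lemma primitive_part (q : 'rV[int]_n) : q != 0 -> exists (g : int) (v : 'rV[int]_n),
  [/\ 0 < g, \big[gcdz/0]_(i < n) v 0 i = 1 & q = g *: v].
Proof.
move=> qn0; pose g := \big[gcdz/0]_(i < n) q 0 i.
have gdvd i : (g %| (q 0%R i : int))%Z.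
  apply: (@big_gcdz_dvd _ _ (fun i => q 0 i) i).
  have : i \in index_enum 'I_n by rewrite mem_index_enum.
  by elim: (index_enum _) => //= j r IH; rewrite inE => /predU1P[->|/IH]; [left|right].
have g0 : 0 < g.
  rewrite lt_def; apply/andP; split.
    apply: contraNneq qn0 => ge0; apply/eqP/rowP => i; rewrite mxE.
    by have := gdvd i; rewrite ge0 dvd0z => /eqP.
  by rewrite /g; case: (index_enum _) => [|i s]; rewrite ?big_nil ?big_cons.
pose v := \row_i ((q 0%R i : int) %/ g)%Z.
have eq : q = g *: v by apply/rowP => i; rewrite !mxE mulrC divzK.
exists g, v; split=> //.
have gn0 : g != 0 by rewrite gt_eqF.
have gM : {morph *%R g : x y / gcdz x y}.
  by move=> x y; rewrite -mulz_gcdr gez0_abs // ltW.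
apply: (mulfI gn0); rewrite mulr1 (big_morph _ gM (mulr0 g)).
by apply: eq_bigr => i _; rewrite !mxE mulrC divzK.
Qed.

Lemma rat_row_int (q : 'rV[rat]_n) : exists (d : int) (p : 'rV[int]_n),
  d != 0 /\ map_mx intr p = d%:~R *: q.
Proof.
exists (\prod_j denq (q 0 j)), (\row_i (numq (q 0 i) * \prod_(j | j != i) denq (q 0 j))).
split; first by apply/prodf_neq0 => j _; rewrite denq_neq0.
apply/rowP => i; rewrite !mxE [in RHS](bigD1 i) //= !intrM.
by rewrite -{3}[q 0 i]divq_num_den; field; rewrite intr_eq0 denq_neq0.
Qed.

Lemma dot_mulmx k (u : 'rV[R]_n) (y : 'rV[R]_k) (M : 'M[R]_(k, n)) :
  dot u (y *m M) = \sum_i y 0 i * dot u (row i M).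
Proof. by rewrite mulmx_sum_row dot_sumr; apply: eq_bigr => i _; rewrite dotZr. Qed.

(** For [a0] in [A] its rows span the direction space and their common orthogonal space is the
    lineality space, so both are given by integer linear data. *)
Definition diffmx (A : {fset 'rV[int]_n}) (a0 : 'rV[int]_n) : 'M[int]_(size A, n) :=
  \matrix_(i, j) ((nth 0 (A : seq _) i) 0 j - a0 0 j).

Lemma flat_diffmx (A : {fset 'rV[int]_n}) (a0 : 'rV[int]_n) (z : 'rV[R]_n) :
  a0 \in A -> flat A z <-> forall i, dot z (row i (map_mx intr (diffmx A a0))) = 0.
Proof.
move=> a0A.
have e i : dot z (row i (map_mx intr (diffmx A a0))) =
    dot (intv R (nth 0 (A : seq _) i)) z - dot (intv R a0) z.
  rewrite -dotBl dotC; congr dot; apply/rowP => j.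
  by rewrite !mxE rmorphB.
split=> [f i|h a b aA bA].
  by rewrite e (f _ a0) ?subrr // mem_nth.
have hh c : c \in A -> dot (intv R c) z = dot (intv R a0) z.
  move=> cA; have ci : (index c A < size A)%N by rewrite index_mem.
  have := h (Ordinal ci); rewrite e /= nth_index // => /eqP.
  by rewrite subr_eq0 => /eqP.
by rewrite !hh.
Qed.

Lemma dirspace_diffmx (A : {fset 'rV[int]_n}) (a0 : 'rV[int]_n) (z : 'rV[R]_n) :
  a0 \in A -> z \in dirspace (conv (pts A)) <->
  exists y, z = y *m map_mx intr (diffmx A a0).
Proof.
move=> a0A; have A0 : A != fset0 by apply/fset0Pn; exists a0.
rewrite mem_dirspace //; set M := map_mx _ _; split=> [h|[y ->] d /(flat_diffmx _ a0A) fd].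
  pose W := limg (linfun (mulmxr M : 'rV[R]_(size A) -> 'rV[R]_n)).
  have [u uW hu] := ortho_decomp W z.
  have fz : flat A (z - u).
    apply/(flat_diffmx _ a0A) => i; rewrite dotC; apply: hu.
    have -> : row i M = linfun (mulmxr M : 'rV[R]_(size A) -> 'rV[R]_n) (delta_mx 0 i).
      by rewrite lfunE /= rowE.
    exact/memv_img/memvf.
  have : z - u == 0 by rewrite -dot_eq0 dotBr h // [dot _ u]dotC hu ?subrr.
  rewrite subr_eq0 => /eqP->; have /memv_imgP[y _ ->] := uW.
  by exists y; rewrite lfunE.
by rewrite dot_mulmx big1 // => i _; rewrite fd mulr0.
Qed.

(* Both conditions on [w] are integral linear equations, so a nonzero real
   solution yields a nonzero rational one. *)
Lemma integral_flat (A B : {fset 'rV[int]_n}) (w : 'rV[R]_n) :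
  A != fset0 -> B != fset0 -> w \in dirspace (conv (pts A)) -> w != 0 -> flat B w ->
  exists q : 'rV[int]_n,
    [/\ q != 0, intv R q \in dirspace (conv (pts A)) & flat B (intv R q)].
Proof.
move=> /fset0Pn[a0 a0A] /fset0Pn[b0 b0B] /(dirspace_diffmx _ a0A)[y ew] wn0 fw.
pose MA : 'M[rat]_(_, _) := map_mx intr (diffmx A a0).
pose MB : 'M[rat]_(_, _) := map_mx intr (diffmx B b0).
have ratrE k l (M : 'M[int]_(k, l)) : map_mx (ratr : rat -> R) (map_mx intr M) = map_mx intr M.
  by apply/matrixP => i j; rewrite !mxE ratr_int.
have flatM (z : 'rV[R]_n) : flat B z <-> z *m (map_mx ratr MB)^T = 0.
  rewrite (flat_diffmx _ b0B) /MB ratrE; set M := map_mx _ _.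
  have e i : (z *m M^T) 0 i = dot z (row i M).
    by rewrite mxE; apply: eq_bigr => j _; rewrite !mxE.
  split=> [h|h i]; first by apply/rowP => i; rewrite e h mxE.
  by rewrite -e h mxE.
(* The rows of [K] span the rational coefficient vectors whose product with [MA] is flat on [B].
   Kernels commute with field extension, so if [K *m MA] were zero, the real solution [w] would
   vanish too. *)
pose K := kermx (MA *m MB^T).
have : (y <= map_mx (ratr : rat -> R) K)%MS.
  rewrite map_kermx; apply/sub_kermxP; rewrite map_mxM -map_trmx mulmxA.
  by rewrite {1}/MA ratrE -ew; apply/flatM.
case/submxP => s ey.
have [i Ki] : exists i, row i (K *m MA) != 0.
  apply: contrapT => h; case/negP: wn0; apply/eqP.
  have KM : K *m MA = 0.
    apply/row_matrixP => i; rewrite row0; apply/eqP.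
    by apply: contrapT => ne; apply: h; exists i; apply/negP.
  by rewrite ew ey -mulmxA -(ratrE _ _ (diffmx A a0)) -/MA -map_mxM KM map_mx0 mulmx0.
have [d [q [dn0 eq]]] := rat_row_int (row i (K *m MA)).
have eqR : intv R q = d%:~R *: (row i (map_mx ratr K) *m map_mx ratr MA).
  rewrite /intv -ratrE eq map_mxZ /= ratr_int; congr (_ *: _).
  by rewrite map_row map_mxM row_mul.
exists q; split.
- apply: contraNneq Ki => q0; move: eq; rewrite q0 map_mx0 => /esym/eqP.
  by rewrite scaler_eq0 intr_eq0 (negbTE dn0).
- rewrite eqR; apply: rpredZ; apply/(dirspace_diffmx _ a0A).
  by exists (row i (map_mx ratr K)); rewrite /MA ratrE.
- rewrite eqR; apply/flatZ/flatM.
  rewrite -mulmxA map_trmx -map_mxM -map_row -map_mxM.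
  have -> : row i K *m (MA *m MB^T) = 0 by rewrite -row_mul mulmx_ker row0.
  by rewrite map_mx0.
Qed.

End Integrality.

(** * Normal cones are generated by the facet normals *)

Section Normals.
Variables (R : realType) (n : nat) (A : {fset 'rV[int]_n}) (A0 : A != fset0).

Notation pts A := [set intv R a | a in [set` A]].
Notation P := (conv (pts A)).
Notation U := (dirspace P).
Implicit Types (w z : 'rV[R]_n) (v : 'rV[int]_n).

Lemma dirspace_flat0 z : z \in U -> flat A z -> z = 0.
Proof. by move=> /(mem_dirspace _ A0) zU /zU /eqP; rewrite dot_eq0 => /eqP. Qed.

Lemma primitive_neq0 v : \big[gcdz/0]_(i < n) v 0 i = 1 -> intv R v != 0.
Proof.
move=> e; apply/eqP; rewrite -[0](intv0 R n) => /intv_inj v0; move: e.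
have -> // : \big[gcdz/0]_(i < n) v 0 i = 0.
by rewrite v0; elim: (index_enum _) => [|i s IH]; rewrite ?big_nil // big_cons IH mxE.
Qed.

(** The direction space of the face always lies in the hyperplane of [U] orthogonal to [v], so
    having codimension one means filling that hyperplane. *)
Lemma facetP v : facet_normal P v <->
  [/\ \big[gcdz/0]_(i < n) v 0 i = 1, intv R v \in U
    & forall z, z \in U -> dot (intv R v) z = 0 ->
      z \in dirspace (conv (pts (fmax A (intv R v))))].
Proof.
have M0 := fmax_neq0 (intv R v) A0.
have sub : (dirspace (conv (pts (fmax A (intv R v)))) <= U :&: dotker (intv R v))%VS.
  apply/subvP => z /(mem_dirspace _ M0) h; rewrite memv_cap mem_dotker h ?eqxx ?andbT.
    by apply/mem_dirspace => // d fd; apply: h; apply: flatS fd => a; apply: fmax_sub.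
  exact: flat_fmax.
rewrite /facet_normal /dimp conv_pts_face //; split=> [] [g vU h]; split=> //.
  move: h; rewrite -(dim_dotker vU (primitive_neq0 g)) => -[h] z zU vz.
  have /eqP -> : dirspace (conv (pts (fmax A (intv R v)))) == (U :&: dotker (intv R v))%VS.
    by rewrite eqEdim sub h leqnn.
  by rewrite memv_cap zU mem_dotker vz eqxx.
rewrite -(dim_dotker vU (primitive_neq0 g)); congr S; apply/eqP; rewrite eqn_leq dimvS //=.
by apply/dimvS/subvP => z; rewrite memv_cap mem_dotker => /andP[zU /eqP]; apply: h.
Qed.

Lemma seq_argmin (T : eqType) (s : seq T) (F : T -> R) x : x \in s ->
  exists2 a, a \in s & forall b, b \in s -> F a <= F b.
Proof.
elim: s x => // y s IH x _; case: s IH => [|x' s] IH.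
  by exists y; rewrite ?mem_head // => b; rewrite inE => /eqP->.
have [a as_ ha] := IH x' (mem_head _ _).
have [le|lt] := leP (F y) (F a).
  exists y; first exact: mem_head.
  by move=> b; rewrite inE => /predU1P[->//|/ha]; apply: le_trans.
exists a; first by rewrite inE as_ orbT.
by move=> b; rewrite inE => /predU1P[->|/ha//]; apply: ltW.
Qed.

Lemma fproperI_ex (K : choiceType) (B C : {fset K}) :
  {subset B <= C} -> (exists2 c, c \in C & c \notin B) -> (B `<` C)%fset.
Proof.
move=> /fsubsetP BC [c cC cB]; rewrite fproperE BC /=.
by apply/negP => /fsubsetP /(_ c cC); rewrite (negbTE cB).
Qed.

(** Move from [w] along [z] until another point first ties with [m]: [F b] is the time at which [b]
    catches up. The old maximizers stay tied with [m] because [z] is constant on them. *)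
Lemma fmax_grow w z m a : m \in fmax A w -> flat (fmax A w) z -> a \in A ->
  dot (intv R m) z < dot (intv R a) z ->
  exists2 t, 0 < t & (fmax A w `<` fmax A (w + t *: z)%R)%fset.
Proof.
move=> mM fz aA ma; have mA := fmax_sub mM.
pose s := [seq b <- A | dot (intv R m) z < dot (intv R b) z].
pose F b := (dot (intv R m) w - dot (intv R b) w) / (dot (intv R b) z - dot (intv R m) z).
have [|c cs hc] := @seq_argmin _ s F a; first by rewrite mem_filter ma.
move: cs; rewrite mem_filter => /andP[mc cA].
have cM : c \notin fmax A w by apply/negP => cM; move: mc; rewrite (fz m c) ?ltxx.
have wc : dot (intv R c) w < dot (intv R m) w.
  rewrite -(supf_fmax mM) lt_def supf_ub // andbT.
  by apply: contraNneq cM => e; rewrite mem_fmax cA e eqxx.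
have t0 : 0 < F c by rewrite divr_gt0 // subr_gt0.
have le b : b \in A -> dot (intv R b) (w + F c *: z) <= dot (intv R m) (w + F c *: z).
  move=> bA; rewrite !dotE; have := supf_ub w bA; rewrite (supf_fmax mM) => bw.
  have [bz|bz] := leP (dot (intv R b) z) (dot (intv R m) z).
    by apply: lerD => //; rewrite ler_pM2l.
  have bs : b \in s by rewrite mem_filter bz.
  by have := hc b bs; rewrite {2}/F ler_pdivlMr ?subr_gt0 //; lra.
exists (F c) => //; apply: fproperI_ex => [b bM|].
  have bA := fmax_sub bM; apply/fmaxP; split=> // d dA.
  apply: le_trans (le d dA) _; rewrite !dotE (fz b m) //.
  by rewrite -(supf_fmax bM) (supf_fmax mM).
exists c => //; apply/fmaxP; split=> // d dA.
apply: le_trans (le d dA) _; rewrite !dotE /F le_eqVlt; apply/orP; left; apply/eqP.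
by field; rewrite subr_eq0 gt_eqF.
Qed.

Variables (r : nat) (H : 'M[int]_(r, n)).
Hypothesis HP : is_Hmatrix H P.

Notation row k := (intv R (row k H)).

(** The last condition restricts the combination to normals of facets through the face of [w], the
    generators of its normal cone. *)
Definition normal_comb w := exists a : 'I_r -> R,
  [/\ forall k, 0 <= a k, w = \sum_k a k *: row k
    & forall k, 0 < a k -> (fmax A w `<=` fmax A (row k))%fset].

Lemma normal_combD w w1 w2 (s1 s2 : R) :
  (fmax A w `<=` fmax A w1)%fset -> (fmax A w `<=` fmax A w2)%fset ->
  normal_comb w1 -> normal_comb w2 -> 0 <= s1 -> 0 <= s2 ->
  w = s1 *: w1 + s2 *: w2 -> normal_comb w.
Proof.
move=> sub1 sub2 [a1 [p1 e1 h1]] [a2 [p2 e2 h2]] s10 s20 ew.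
exists (fun k => s1 * a1 k + s2 * a2 k); split.
- by move=> k; rewrite addr_ge0 // mulr_ge0.
- rewrite ew {1}e1 {1}e2 !scaler_sumr -big_split; apply: eq_bigr => k _.
  by rewrite scalerDl !scalerA.
move=> k kp; have [a1p|a1n] := ltP 0 (a1 k); first exact: fsubset_trans (h1 k a1p).
have [a2p|a2n] := ltP 0 (a2 k); first exact: fsubset_trans (h2 k a2p).
have z1 : a1 k = 0 by apply/eqP; rewrite eq_le a1n p1.
have z2 : a2 k = 0 by apply/eqP; rewrite eq_le a2n p2.
by move: kp; rewrite z1 z2 !mulr0 addr0 ltxx.
Qed.

(** When the directions flat on the face are only the multiples of [w], integrality of these
    conditions makes [w] a positive multiple of a primitive integral vector, and its face has
    codimension one. *)
Lemma normal_ray w : w \in U -> w != 0 ->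
  (forall z, z \in U -> flat (fmax A w) z -> exists k, z = k *: w) -> normal_comb w.
Proof.
move=> wU wn0 ray; have M0 := fmax_neq0 w A0.
have [q [qn0 qU fq]] := integral_flat A0 M0 wU wn0 (flat_fmax (z:=w)).
(* The integral vector [q] may point opposite to [w]; its sign is corrected here. *)
have [q' [k [q'n0 k0 eq']]] : exists (q' : 'rV[int]_n) k, [/\ q' != 0, 0 < k & intv R q' = k *: w].
  have [k ek] := ray _ qU fq; have [k0|k0|k0] := ltgtP k 0.
  - by exists (- q), (- k); rewrite oppr_eq0 oppr_gt0 intvN ek scaleNr.
  - by exists q, k.
  - move: ek; rewrite k0 scale0r -(intv0 R n) => /intv_inj e.
    by rewrite e eqxx in qn0.
have [g [v [g0 gv ev]]] := primitive_part q'n0.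
have gR0 : 0 < (g%:~R : R) by rewrite ltr0z.
have vw : intv R v = (g%:~R^-1 * k) *: w.
  by rewrite -scalerA -eq' ev intvZ scalerA mulVf ?gt_eqF // scale1r.
have c0 : 0 < g%:~R^-1 * k by rewrite mulr_gt0 ?invr_gt0.
have fv : facet_normal P v.
  apply/facetP; split=> //; first by rewrite vw rpredZ.
  move=> z zU; rewrite vw fmaxZ // dotZl => /eqP; rewrite mulf_eq0 gt_eqF //= => /eqP wz.
  apply/mem_dirspace => // d fd; have [u uU hu] := ortho_decomp U d.
  have fo : flat A (d - u) by apply: ortho_flat.
  have [k' ek] : exists k', u = k' *: w.
    apply: ray => //; have -> : u = d - (d - u) by rewrite opprB addrC subrK.
    by apply: flatD => //; apply: flatN; apply: flatS fo => a; apply: fmax_sub.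
  have := hu z zU; rewrite dotC dotBl ek dotZl wz mulr0 subr0 //.
have [i ei] := (HP.2 v).1 fv.
exists (fun j => if j == i then (g%:~R^-1 * k)^-1 else 0); split.
- by move=> j; case: eqP => // _; rewrite invr_ge0 ltW.
- rewrite (bigD1 i) //= eqxx big1 ?addr0 => [|j /negbTE->]; last by rewrite scale0r.
  by rewrite ei vw scalerA mulVf ?scale1r ?gt_eqF.
- move=> j; case: eqP => [-> _|]; last by rewrite ltxx.
  by rewrite ei vw fmaxZ // fsubset_refl.
Qed.

(** Induction on the number of points of [A] off the face of [w]. If [w] is not a ray, move from [w]
    both ways along a second direction [y] flat on its face until the face grows, and write [w] as a
    combination of vectors with larger faces. *)
Lemma normal_cone w : w \in U -> normal_comb w.
Proof.
move: {2}(#|`A| - #|`fmax A w|)%N (leqnn (#|`A| - #|`fmax A w|)%N) => N.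
elim: N w => [|N IH] w hN wU.
  have [->|wn0] := eqVneq w 0.
    exists (fun=> 0); split=> // [|k]; last by rewrite ltxx.
    by rewrite big1 // => k _; rewrite scale0r.
  case/negP: wn0; apply/eqP/dirspace_flat0/fmax_flat => //.
  apply/eqP; rewrite eqEfcard; apply/andP; split; last by rewrite -subn_eq0 -leqn0.
  by apply/fsubsetP => a; apply: fmax_sub.
have [w0|wn0] := eqVneq w 0.
  exists (fun=> 0); split=> // [|k]; last by rewrite ltxx.
  by rewrite big1 // => k _; rewrite scale0r.
have [ray|nray] := pselect (forall z, z \in U -> flat (fmax A w) z -> exists k, z = k *: w).
  exact: normal_ray.
have [z [zU fz nz]] : exists z, [/\ z \in U, flat (fmax A w) z & forall k, z <> k *: w].
  apply: contrapT => h; apply: nray => z zU fz; apply: contrapT => hk; apply: h.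
  by exists z; split=> // k e; apply: hk; exists k.
have /fset0Pn[m mM] := fmax_neq0 w A0; have mA := fmax_sub mM.
have [p pA pM] : exists2 p, p \in A & p \notin fmax A w.
  apply: contrapT => h; case/negP: wn0; apply/eqP/dirspace_flat0 => //; apply: fmax_flat.
  apply/fsetP => p; apply/idP/idP => [/fmax_sub//|pA].
  by apply: contrapT => /negP pM; apply: h; exists p.
have wp : dot (intv R p) w < dot (intv R m) w.
  rewrite -(supf_fmax mM) lt_def supf_ub // andbT.
  by apply: contraNneq pM => e; rewrite mem_fmax pA e eqxx.
(* Chosen so that [y] takes the same value at [p], which is off the face, as at [m]; this makes the
   face of an unobstructed direction strictly larger. *)
pose k := (dot (intv R p) z - dot (intv R m) z) / (dot (intv R p) w - dot (intv R m) w).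
pose y := z - k *: w.
have yU : y \in U by rewrite rpredB ?rpredZ.
have yn0 : y != 0 by apply/eqP => /eqP; rewrite subr_eq0 => /eqP /nz.
have fy : flat (fmax A w) y by apply: flatD => //; apply/flatN/flatZ/flat_fmax.
have yp : dot (intv R p) y = dot (intv R m) y.
  by rewrite /y !dotE /k; field; rewrite subr_eq0 lt_eqF.
have IH' w' : w' \in U -> (fmax A w `<` fmax A w')%fset -> normal_comb w'.
  move=> w'U lt; apply: IH => //.
  have := fproper_ltn_card lt; have : (#|`fmax A w'| <= #|`A|)%N.
    by apply/fsubset_leq_card/fsubsetP => a; apply: fmax_sub.
  by move: hN; lia.
have up y' : y' \in U -> flat (fmax A w) y' ->
    (exists2 a, a \in A & dot (intv R m) y' < dot (intv R a) y') ->
    exists t, [/\ 0 < t, normal_comb (w + t *: y')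
      & (fmax A w `<=` fmax A (w + t *: y')%R)%fset].
  move=> y'U fy' [a aA ha]; have [t t0 lt] := fmax_grow mM fy' aA ha.
  exists t; split=> //; first by apply: IH' => //; rewrite rpredD ?rpredZ.
  exact: fproper_sub.
(* If nothing obstructs the move along [y'], then [y'] itself has a larger face, containing [p]. The
   move along [-y'] does stop, and [w] is the sum of its endpoint and a multiple of [y']. *)
have side y' : y' \in U -> y' != 0 -> flat (fmax A w) y' ->
    dot (intv R p) y' = dot (intv R m) y' ->
    (forall a, a \in A -> dot (intv R a) y' <= dot (intv R m) y') -> normal_comb w.
  move=> y'U y'n0 fy' y'p le.
  have lt : (fmax A w `<` fmax A y')%fset.
    apply: fproperI_ex => [a aM|].
      by apply/fmaxP; split=> [|b bA]; [exact: fmax_sub aM|rewrite (fy' a m) ?le].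
    by exists p => //; apply/fmaxP; split=> // b bA; rewrite y'p le.
  have [|||t [t0 nc sub]] := up (- y'); rewrite ?rpredN //; first exact: flatN.
    apply: contrapT => h; case/negP: y'n0; apply/eqP/dirspace_flat0 => //.
    have eqm a : a \in A -> dot (intv R a) y' = dot (intv R m) y'.
      move=> aA; apply/eqP; rewrite eq_le le // leNgt; apply/negP => lt'.
      by apply: h; exists a => //; rewrite !dotE ltrN2.
    by move=> a b aA bA; rewrite !eqm.
  apply: (normal_combD sub (fproper_sub lt) nc (IH' _ y'U lt) ler01 (ltW t0)).
  by rewrite scale1r scalerN subrK.
have [hp|np] := pselect (exists2 a, a \in A & dot (intv R m) y < dot (intv R a) y); last first.
  apply: (side y) => // a aA; rewrite leNgt; apply/negP => lt.
  by apply: np; exists a.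
have [hn|nn] := pselect (exists2 a, a \in A & dot (intv R m) (- y) < dot (intv R a) (- y)); last first.
  apply: (side (- y)); rewrite ?rpredN ?oppr_eq0 //; first exact: flatN.
    by rewrite !(dotNr _ y) yp.
  by move=> a aA; rewrite leNgt; apply/negP => lt; apply: nn; exists a.
have [t1 [t10 nc1 sub1]] := up y yU fy hp.
have [|t2 [t20 nc2 sub2]] := up (- y) _ (flatN fy) hn; first by rewrite rpredN.
have t12 : 0 < t1 + t2 by rewrite addr_gt0.
apply: (normal_combD (s1 := t2 / (t1 + t2)) (s2 := t1 / (t1 + t2)) sub1 sub2 nc1 nc2).
- by rewrite divr_ge0 ?ltW.
- by rewrite divr_ge0 ?ltW.
apply/rowP => i; rewrite !mxE; field.
by rewrite gt_eqF.
Qed.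

End Normals.

(** Local linearity at every point gives global affineness: real induction along the segment from 0
    to [x] carries both the value and the slope of [phi]. *)
Lemma affine_of_near0 (R : realType) (n : nat) (phi : 'rV[R]_n -> R) (e : 'rV[R]_n -> 'rV[R]_n) :
  (forall x w, near0 (fun t => phi (x + t *: w) = phi x + t * dot (e x) w)) ->
  forall x, phi x = phi 0 + dot (e 0) x.
Proof.
move=> hphi x.
have two y : near0 (fun t => phi (y + t *: x) = phi y + t * dot (e y) x /\
    phi (y - t *: x) = phi y - t * dot (e y) x).
  apply: near0S (near0_and (hphi y x) (hphi y (- x))) => t _ [h1 h2]; split=> //.
  by rewrite -scalerN h2 dotNr mulrN.
pose P t := phi (t *: x) = phi 0 + t * dot (e 0) x /\ dot (e (t *: x)) x = dot (e 0) x.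
suff [] : P 1 by rewrite scale1r mul1r.
apply: real_ind => // [|t t0 [P1 P2]|t t0].
- by rewrite /P !scale0r mul0r addr0.
- have [d d0 hd] := two (t *: x); exists d => // s /andP[s0 sd].
  have e1 t' : 0 <= t' -> t' < d -> phi ((t + t') *: x) = phi 0 + (t + t') * dot (e 0) x.
    rewrite le_eqVlt => /predU1P[<-|t'0 t'd]; first by rewrite !addr0.
    by rewrite scalerDl (hd t' _).1 ?t'0 // P1 P2; ring.
  split; first by apply: e1; rewrite ?ltW.
  have [d' d'0 hd'] := two ((t + s) *: x).
  (* At parameter [t + s - q] the expansions at [t] and at [t + s] both apply; comparing them
     equates the slopes. The left-limit case below compares at [t - s + q] in the same way. *)
  pose q := Num.min (d' / 2) s.
  have q0 : 0 < q by rewrite lt_min s0 andbT; lra.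
  have qd : q < d' by rewrite gt_min; apply/orP; left; lra.
  have qs : q <= s by rewrite ge_min lexx orbT.
  have [|_] := hd' q; first by rewrite q0.
  rewrite -scalerBl -addrA !e1 ?subr_ge0 //; try lra.
  by move=> eqd; apply: (mulfI (lt0r_neq0 q0)); move: eqd; lra.
- have [d d0 hd] := two (t *: x); exists d => // s /andP[s0 sd] [P1 P2].
  have hleft s' : 0 <= s' -> s' < d ->
      phi ((t - s') *: x) = phi (t *: x) - s' * dot (e (t *: x)) x.
    rewrite le_eqVlt => /predU1P[<-|s'0 s'd]; first by rewrite mul0r !subr0.
    by rewrite scalerBl (hd s' _).2 ?s'0.
  have [d' d'0 hd'] := two ((t - s) *: x).
  pose q := Num.min (d' / 2) s.
  have q0 : 0 < q by rewrite lt_min s0 andbT; lra.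
  have qd : q < d' by rewrite gt_min; apply/orP; left; lra.
  have qs : q <= s by rewrite ge_min lexx orbT.
  have eq : dot (e (t *: x)) x = dot (e 0) x.
    have [|+ _] := hd' q; first by rewrite q0.
    rewrite -scalerDl P2.
    have -> : t - s + q = t - (s - q) by ring.
    rewrite !hleft //; try lra.
    by move=> eqd; apply: (mulfI (lt0r_neq0 q0)); move: eqd; lra.
  split=> //; have := hleft s (ltW s0) sd; rewrite P1 eq; lra.
Qed.

(** * Multiplicity vectors over a family of polytopes with independent support functions *)

Section Types.
Variables (R : realType) (n : nat) (I : finType) (A : I -> {fset 'rV[int]_n}).
Hypothesis A0 : forall i, A i != fset0.
Implicit Types (B : {fset 'rV[int]_n}) (y : I -> int) (x w z v : 'rV[R]_n).

Notation h i := (@supf R n (A i)).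

(** Up to a lattice translation, the convex hull of [B] is the Minkowski combination with
    multiplicities [y]; in terms of support functions this also makes sense for negative [y]. *)
Definition typed B y := exists u : 'rV[int]_n, forall z,
  supf B z = dot (intv R u) z + \sum_i (y i)%:~R * h i z.

Hypothesis indep : forall (u : 'rV[int]_n) y,
  (forall z, dot (intv R u) z + \sum_i (y i)%:~R * h i z = 0) -> forall i, y i = 0.

Lemma indep_eq (u u' : 'rV[int]_n) y y' :
  (forall z, dot (intv R u) z + \sum_i (y i)%:~R * h i z =
             dot (intv R u') z + \sum_i (y' i)%:~R * h i z) -> y =1 y'.
Proof.
move=> e i; apply/eqP; rewrite -subr_eq0; apply/eqP.
apply: (@indep (u - u') (fun i => y i - y' i)) => z.
rewrite intvB dotBl; under eq_bigr do rewrite rmorphB mulrBl.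
by rewrite sumrB addrACA -opprD e subrr.
Qed.

Lemma typed_uniq B y y' : typed B y -> typed B y' -> y =1 y'.
Proof. by move=> [u hu] [u' hu']; apply: (@indep_eq u u') => z; rewrite -hu -hu'. Qed.

Lemma typed_self i : typed (A i) (fun j => (i == j)%:Z).
Proof.
exists 0 => z; rewrite intv0 dot0l add0r (bigD1 i) //= eqxx mul1r big1 ?addr0 // => j.
by rewrite eq_sym => /negbTE->; rewrite mul0r.
Qed.

Lemma typed_point a : typed [fset a]%fset (fun=> 0).
Proof.
exists a => z; rewrite supf1 big1 ?addr0 // => i _.
by rewrite mul0r.
Qed.

Lemma typed_flat B y j z : B != fset0 -> (forall i, 0 <= y i) -> typed B y ->
  y j != 0 -> flat B z -> flat (A j) z.
Proof.
move=> B0 y0 [u hu] yj fz.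
apply: (supf_comb_flat (fun p _ => A0 p) B0 hu _ _).1 fz _ _ _; rewrite ?intr_eq0 //.
by move=> p _; rewrite ler0z.
Qed.

(* [c w i j] is the multiplicity of the j-th polytope in the face of the i-th one
   in direction [w]. *)
Variable c : 'rV[R]_n -> I -> I -> int.
Hypothesis c_ge0 : forall w i j, 0 <= c w i j.
Hypothesis c_typed : forall w i, typed (fmax (A i) w) (c w i).

(** The linear action on multiplicities of passing to the face in direction [w]. *)
Definition faceL w y j : int := \sum_i y i * c w i j.

Lemma typed_fmax B y w : B != fset0 -> typed B y -> typed (fmax B w) (faceL w y).
Proof.
move=> B0 [u hu].
have /choice[ui hui] : forall i, exists ui : 'rV[int]_n, forall z,
    supf (fmax (A i) w) z = dot (intv R ui) z + \sum_j (c w i j)%:~R * h j z.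
  by move=> i; apply: c_typed.
exists (u + \sum_i y i *: ui i) => z.
rewrite (supf_comb_fmax (fun p _ => A0 p) B0 hu w z) intvD intv_sum dotDl dot_suml -addrA; congr (_ + _).
under eq_bigr => i _ do rewrite hui mulrDr.
rewrite big_split /=; congr (_ + _); first by apply: eq_bigr => i _; rewrite intvZ dotZl.
under [RHS]eq_bigr => i _ do rewrite /faceL rmorph_sum mulr_suml.
rewrite exchange_big; apply: eq_bigr => i _; rewrite mulr_sumr.
by apply: eq_bigr => j _; rewrite rmorphM /= mulrA.
Qed.

Lemma c_flat w i j : flat (A i) w -> c w i j = (i == j)%:Z.
Proof.
move=> f; have := c_typed w i; rewrite flat_fmaxE // => ty.
exact: (typed_uniq ty (typed_self i)).
Qed.

Lemma c_point w i j a : fmax (A i) w = [fset a]%fset -> c w i j = 0.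
Proof.
by move=> e; have := c_typed w i; rewrite e => ty; apply: (typed_uniq ty (typed_point a)).
Qed.

Lemma c_fmax w w' i : fmax (A i) w = fmax (A i) w' -> c w i =1 c w' i.
Proof. by move=> e; apply: typed_uniq (c_typed w i) _; rewrite e; apply: c_typed. Qed.

Lemma c_sub w i j z : c w i j != 0 -> flat (fmax (A i) w) z -> flat (A j) z.
Proof. by apply: typed_flat => //; rewrite ?fmax_neq0. Qed.

Lemma c_dir w i j : c w i j != 0 -> flat (A j) w.
Proof. by move=> /c_sub; apply; apply: flat_fmax. Qed.

Lemma c_comp w v i m : m \in fmax (A i) w -> m \in fmax (A i) v ->
  c (w + v) i =1 faceL v (c w i).
Proof.
move=> mw mv; apply: typed_uniq (c_typed _ _) _; rewrite (fmaxD mw mv).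
by apply: typed_fmax (c_typed w i); rewrite fmax_neq0.
Qed.

Lemma c_expand x w i : near0 (fun t => c (x + t *: w) i =1 faceL w (c x i)).
Proof.
apply: near0S (supf_expand x w (A0 i)) => t t0 [e _].
apply: typed_uniq (c_typed _ _) _; rewrite e.
by apply: typed_fmax (c_typed x i); rewrite fmax_neq0.
Qed.

Lemma faceL_le w y y' j : (forall i, y i <= y' i) -> faceL w y j <= faceL w y' j.
Proof. by move=> le; apply: ler_sum => i _; rewrite ler_wpM2r. Qed.

(** The number of j with D_j contained in D_i: it increases strictly with D_i, so induction on
    inclusion becomes induction on numbers. *)
Definition rk i := #|[pred j | `[< forall z, flat (A j) z -> flat (A i) z >]]|.

(** A summand of a face of [A j] is flat wherever [A j] is, and also along [w], where [A j] is not: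
    D_j is strictly inside D_i. *)
Lemma c_rk w j i : c w j i != 0 -> ~ flat (A j) w -> (rk j < rk i)%N.
Proof.
move=> cn0 nf.
have sub z : flat (A j) z -> flat (A i) z.
  by move=> fz; apply: (c_sub cn0); apply: flatS fz => a; apply: fmax_sub.
apply: proper_card; apply/properP; split.
  by apply/fintype.subsetP => k; rewrite !inE => hk z /hk /sub.
exists i; first by rewrite inE.
by apply/negP; rewrite inE => hi; apply/nf/hi/c_dir/cn0.
Qed.

(** * How the remaining multiplicities change from point to point *)

Section Dynamics.
Variable delta : 'rV[R]_n -> I -> int.
Hypothesis delta_ge0 : forall x i, 0 <= delta x i.
Hypothesis delta_expand : forall x w,
  near0 (fun t => delta (x + t *: w) =1 faceL w (delta x)).

Variable i : I.
Hypothesis i_min : forall j x, delta x j != 0 -> (rk i <= rk j)%N.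

(** Type [i] could only be gained from a type not flat along [w]; by [c_rk] that type has smaller
    rank, hence multiplicity zero. *)
Lemma delta_flat_near x w : flat (A i) w -> near0 (fun t => delta (x + t *: w) i = delta x i).
Proof.
move=> fw; apply: near0S (delta_expand x w) => t t0 ->.
rewrite /faceL (bigD1 i) //= c_flat // eqxx mulr1 big1 ?addr0 // => j ji.
have [fj|nfj] := pselect (flat (A j) w); first by rewrite c_flat // (negbTE ji) mulr0.
have [->|dj] := eqVneq (delta x j) 0; first by rewrite mul0r.
have [->|cn0] := eqVneq (c w j i) 0; first by rewrite mulr0.
by have := c_rk cn0 nfj; rewrite ltnNge (i_min dj).
Qed.

Lemma delta_flat x w : flat (A i) w -> delta (x + w) i = delta x i.
Proof.
move=> fw; rewrite -[w]scale1r.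
apply: (real_ind (P := fun t => delta (x + t *: w) i = delta x i)) => // [|t t0 Pt|t t0].
- by rewrite scale0r addr0.
- apply: near0S (delta_flat_near (x + t *: w) fw) => e _ he.
  by rewrite scalerDl addrA he Pt.
- apply: near0S (delta_flat_near (x + t *: w) (flatN fw)) => e _ he.
  by rewrite scalerBl addrA -scalerN he.
Qed.

(** The positivity axiom for [v] on generating points: the face in direction [-v] is the whole
    polytope or a vertex, never proper. *)
Definition posdir v := forall j, flat (A j) v \/ exists a, fmax (A j) (- v) = [fset a]%fset.

Lemma delta_mono j x v (a : R) : posdir v -> flat (A j) v -> 0 <= a ->
  delta x j <= delta (x + a *: v) j.
Proof.
move=> pv fv; apply: (real_ind (P := fun a => delta x j <= delta (x + a *: v) j)).
- by rewrite scale0r addr0.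
- move=> t t0 Pt; apply: near0S (delta_expand (x + t *: v) v) => e _ he.
  rewrite scalerDl addrA he; apply: le_trans Pt _.
  rewrite /faceL (bigD1 j) //= c_flat // eqxx mulr1 lerDl.
  by apply: sumr_ge0 => k _; rewrite mulr_ge0.
- move=> t t0; apply: near0S (delta_expand (x + t *: v) (- v)) => e _ he.
  rewrite scalerBl addrA -scalerN he => le; apply: le_trans le _.
  rewrite /faceL (bigD1 j) //= c_flat ?eqxx ?mulr1; last exact: flatN.
  rewrite big1 ?addr0 // => k kj; have [fk|[b eb]] := pv k.
    by rewrite c_flat ?(negbTE kj) ?mulr0 //; apply: flatN.
  by rewrite (c_point _ eb) mulr0.
Qed.

Lemma dominate_step x0 w v (a : R) m : posdir v -> 0 <= a ->
  m \in fmax (A i) w -> m \in fmax (A i) v ->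
  (forall j, c w i j <= delta (x0 + w) j) ->
  forall j, c (w + a *: v) i j <= delta (x0 + (w + a *: v)) j.
Proof.
move=> pv; rewrite le_eqVlt => /predU1P[<-|a0] mw mv le j; first by rewrite scale0r addr0.
have mav : m \in fmax (A i) (a *: v) by rewrite fmaxZ.
have cE : c (w + a *: v) i j = faceL v (c w i) j.
  rewrite (c_comp mw mav) /faceL; apply: eq_bigr => k _; congr (_ * _).
  by apply: c_fmax; rewrite fmaxZ.
have [->//|cn0] := eqVneq (c (w + a *: v) i j) 0.
have fv : flat (A j) v.
  apply: (c_sub cn0); rewrite (fmaxD mw mav) fmaxZ //; exact: flat_fmax.
have [e e0 he] := delta_expand (x0 + w) v.
pose d := Num.min (e / 2) a.
have d0 : 0 < d by rewrite lt_min a0 andbT; lra.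
have de : d < e by rewrite gt_min; apply/orP; left; lra.
have da : d <= a by rewrite ge_min lexx orbT.
have -> : x0 + (w + a *: v) = (x0 + w + d *: v) + (a - d) *: v.
  by apply/rowP => k; rewrite !mxE; ring.
apply: le_trans (delta_mono _ pv fv _); last by rewrite subr_ge0.
by rewrite he ?d0 // cE; apply: faceL_le.
Qed.

Variables (r : nat) (row : 'I_r -> 'rV[R]_n).
Hypothesis row_cone : forall w, exists (d : 'rV[R]_n) (a : 'I_r -> R),
  [/\ forall j, flat (A j) d, forall k, 0 <= a k, w = d + \sum_k a k *: row k
    & forall k j, 0 < a k -> {subset fmax (A j) w <= fmax (A j) (row k)}].
Hypothesis row_pos : forall k j, ~ flat (A j) (row k) ->
  (forall a, fmax (A j) (row k) <> [fset a]%fset) -> posdir (row k).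

Lemma dominate x0 w j : 0 < delta x0 i -> c w i j <= delta (x0 + w) j.
Proof.
move=> d0; have [[a ea]|nsing] := pselect (exists a, fmax (A i) w = [fset a]%fset).
  by rewrite (c_point _ ea).
have [d [a [fd a0 ew sub]]] := row_cone w.
have /fset0Pn[m mw] := fmax_neq0 w (A0 i); have mA := fmax_sub mw.
pose Q k := `[< flat (A i) (row k) >].
(* The part of [w] collected in D_i: along it [delta i] is constant and the face of [A i] is all of
   [A i], so the bound holds at the start of the walk because [delta x0 i] is at least 1. *)
pose d' := d + \sum_(k | Q k) a k *: row k.
have fd' : flat (A i) d'.
  apply: flatD => //; elim/big_ind: _ => [|u u' fu fu'|k /asboolP fk].
  - exact: flat0.
  - exact: flatD.
  - exact: flatZ.
pose ws s := d' + \sum_(k <- s) a k *: row k.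
have walk s : all (predC Q) s -> m \in fmax (A i) (ws s) /\
    forall j, c (ws s) i j <= delta (x0 + ws s) j.
  elim: s => [_|k s IH /andP[/asboolP nfk /IH[ms les]]].
    rewrite /ws big_nil addr0; split; first by rewrite flat_fmaxE.
    move=> k; rewrite c_flat //; case: eqP => [<-|_] //.
    by rewrite delta_flat.
  have -> : ws (k :: s) = ws s + a k *: row k.
    by rewrite /ws big_cons addrCA addrC.
  have := a0 k; rewrite le_eqVlt => /predU1P[<-|ak]; first by rewrite scale0r addr0.
  have mk : m \in fmax (A i) (row k) by apply: sub ak _ mw.
  have mak : m \in fmax (A i) (a k *: row k) by rewrite fmaxZ.
  split.
    rewrite (fmaxD ms mak); apply/fmaxP; split=> // b /fmax_sub bA.
    by move/fmaxP: mak => [_]; apply.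
  apply: dominate_step ms mk les; last exact: a0.
  (* Were the face of [A i] in direction [row k] a vertex, the face in direction [w] inside it would
     be that vertex, a case already excluded. *)
  apply: row_pos nfk _ => b eb; apply: nsing; exists b.
  have subb b' : b' \in fmax (A i) w -> b' = b.
    by move=> /(sub k i ak); rewrite eb inE => /eqP.
  apply/fsetP => b'; rewrite inE; apply/idP/eqP => [/subb//|->].
  by rewrite -(subb m).
have -> : w = ws [seq k <- index_enum 'I_r | ~~ Q k].
  by rewrite /ws big_filter {1}ew (bigID Q) /= addrA.
by have [|_] := walk [seq k <- index_enum 'I_r | ~~ Q k]; first exact: filter_all.
Qed.

End Dynamics.

(** * Products of units and the recovery of their factors from local multiplicities *)

Section Keys.
Implicit Types s : seq (I * 'rV[R]_n).

(* A canonical representative of [p.2] modulo the lineality space of the p.1-th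
   polytope: [xget] depends only on the set it is applied to. *)
Definition key (p : I * 'rV[R]_n) : I * 'rV[R]_n :=
  (p.1, xget 0 [set z | flat (A p.1) (z - p.2)]).

Lemma key_flat p : flat (A p.1) ((key p).2 - p.2).
Proof.
have : exists z, [set z | flat (A p.1) (z - p.2)] z.
  by exists p.2; rewrite /= subrr; apply: flat0.
exact: xgetPex.
Qed.

Lemma eq_key p q : key p = key q <-> p.1 = q.1 /\ flat (A p.1) (p.2 - q.2).
Proof.
split=> [e|[e f]].
  have e1 : p.1 = q.1 by have := congr1 fst e.
  split=> //; have -> : p.2 - q.2 = ((key q).2 - q.2) - ((key p).2 - p.2).
    by rewrite e; apply/rowP => k; rewrite !mxE; ring.
  by apply: flatD; [rewrite e1; apply: key_flat|apply/flatN/key_flat].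
rewrite /key -e; congr (_, xget _ _); apply/seteqP; split=> z /= fz.
  by have -> : z - q.2 = (z - p.2) + (p.2 - q.2); [rewrite addrA subrK|apply: flatD].
by have -> : z - p.2 = (z - q.2) - (p.2 - q.2);
  [rewrite opprB addrA subrK|apply: flatD => //; apply: flatN].
Qed.

Lemma c_key p x j : c (x - (key p).2) p.1 j = c (x - p.2) p.1 j.
Proof.
apply: c_fmax; rewrite -(fmax_flatD (x - p.2) (flatN (@key_flat p))).
by congr fmax; rewrite opprB addrA subrK.
Qed.

(** The multiplicities of the local cell at [x] of the product of the units listed in [s], each
    given by a type and an apex. *)
Definition mult s x j : int := \sum_(p <- s) c (x - p.2) p.1 j.

Definition unitsum s x : R := \sum_(p <- s) h p.1 (x - p.2).

Lemma mult_expand s x w :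
  near0 (fun t => mult s (x + t *: w) =1 faceL w (mult s x)).
Proof.
have e : near0 (fun t => forall p, p \in s ->
    c (x - p.2 + t *: w) p.1 =1 faceL w (c (x - p.2) p.1)).
  by apply: near0_all => p _; apply: c_expand.
apply: near0S e => t _ e j; rewrite /mult /faceL.
under [RHS]eq_bigr do rewrite mulr_suml.
rewrite exchange_big big_seq [RHS]big_seq; apply: eq_bigr => p ps.
by rewrite addrAC e.
Qed.

Lemma unitsum_expand s x : exists u : 'rV[int]_n, forall w, near0 (fun t =>
  unitsum s (x + t *: w) = unitsum s x +
    t * (dot (intv R u) w + \sum_j (mult s x j)%:~R * h j w)).
Proof.
have /choice[up hup] : forall p : I * 'rV[R]_n, exists u : 'rV[int]_n, forall z,
    supf (fmax (A p.1) (x - p.2)) z =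
    dot (intv R u) z + \sum_j (c (x - p.2) p.1 j)%:~R * h j z.
  by move=> p; apply: c_typed.
exists (\sum_(p <- s) up p) => w.
have e : near0 (fun t => forall p, p \in s ->
    h p.1 (x - p.2 + t *: w) = h p.1 (x - p.2) + t * supf (fmax (A p.1) (x - p.2)) w).
  apply: near0_all => p _.
  by apply: near0S (supf_expand (x - p.2) w (A0 p.1)) => t _ [].
apply: near0S e => t _ e; rewrite /unitsum big_seq.
under eq_bigr => p ps do rewrite addrAC e //.
rewrite -big_seq big_split /=; congr (_ + _); rewrite -mulr_sumr; congr (_ * _).
under [LHS]eq_bigr do rewrite hup.
rewrite big_split /= intv_sum dot_suml; congr (_ + _); rewrite exchange_big.
by apply: eq_bigr => j _; rewrite /mult rmorph_sum mulr_suml.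
Qed.

(** Both sides have the same directional derivatives at [x] up to a linear term, and independence of
    the support functions identifies the multiplicities. *)
Lemma mult_uniq s s' : (exists (k : R) (u : 'rV[int]_n), forall x,
    unitsum s x = k + dot (intv R u) x + unitsum s' x) ->
  forall x, mult s x =1 mult s' x.
Proof.
move=> [k [u e]] x.
have [v hv] := unitsum_expand s x; have [v' hv'] := unitsum_expand s' x.
apply: (@indep_eq v (u + v')) => w.
have [t t0 [e1 e2]] := near0_ex (near0_and (hv w) (hv' w)).
move: e1; rewrite e e2 (e x) dotDr dotZr intvD dotDl => e1.
by apply: (mulfI (lt0r_neq0 t0)); move: e1; lra.
Qed.

Lemma mult_count s x j (U : seq (I * 'rV[R]_n)) : uniq U -> {subset map key s <= U} ->
  mult s x j = \sum_(q <- U) (count_mem q (map key s))%:Z * c (x - q.2) q.1 j.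
Proof.
move=> uU; elim: s => [_|p s IH sub]; rewrite /mult ?big_nil ?big_cons.
  by rewrite big1 // => q _; rewrite mul0r.
rewrite -/(mult s x j) IH => [|q qs]; last by apply: sub; rewrite inE qs orbT.
under [RHS]eq_bigr do rewrite /= PoszD mulrDl.
rewrite big_split /=; congr (_ + _).
rewrite (bigD1_seq (key p)) ?sub ?mem_head //= eqxx mul1r c_key big1 ?addr0 // => q.
by rewrite eq_sym => /negbTE->; rewrite mul0r.
Qed.

Lemma keyK p : key (key p) = key p.
Proof. by apply/eq_key; split=> //; exact: (@key_flat p). Qed.

(** Induction on rank, reading the multiplicity of type [q.1] at the apex [q.2]. Units with key [q]
    contribute 1 each; any other contribution comes from a type of strictly smaller rank, whose
    counts already agree. *)
Lemma keys_uniq s s' : (forall x, mult s x =1 mult s' x) ->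
  perm_eq (map key s) (map key s').
Proof.
move=> e; pose U := undup (map key s ++ map key s').
have uU : uniq U by apply: undup_uniq.
have sU : {subset map key s <= U} by move=> q qs; rewrite mem_undup mem_cat qs.
have s'U : {subset map key s' <= U} by move=> q qs; rewrite mem_undup mem_cat qs orbT.
have UK q : q \in U -> key q = q.
  by rewrite mem_undup mem_cat => /orP[] /mapP[p _ ->]; apply: keyK.
suff H N q : q \in U -> (rk q.1 < N)%N -> count_mem q (map key s) = count_mem q (map key s').
  by apply/allP => q; rewrite -mem_undup => qU; apply/eqP/(H (rk q.1).+1).
elim: N q => // N IH q qU ltN.
have := e q.2 q.1; rewrite !(@mult_count _ _ _ U) // => /eqP.
rewrite -subr_eq0 -sumrB (bigD1_seq q) //= subrr c_flat ?eqxx ?mulr1; last exact: flat0.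
rewrite big1_seq ?addr0 => [/eqP/eqP|q' /andP[q'q q'U]].
  by rewrite subr_eq0 => /eqP [].
have [f|nf] := pselect (flat (A q'.1) (q.2 - q'.2)).
  rewrite c_flat //; case: eqP => [e1|_]; last by rewrite !mulr0 subrr.
  case/eqP: q'q; rewrite -(UK q') // -(UK q) //; apply/eq_key; split=> //.
  by rewrite -opprB; apply: flatN.
have [->|cn0] := eqVneq (c (q.2 - q'.2) q'.1 q.1) 0; first by rewrite !mulr0 subrr.
by rewrite IH ?subrr //; apply: leq_trans (c_rk cn0 nf) _.
Qed.

End Keys.

(** * Subtracting units until nothing remains *)

Section Decomposition.
Implicit Types s : seq (I * 'rV[R]_n).
Variables (r : nat) (row : 'I_r -> 'rV[R]_n).
Hypothesis row_cone : forall w, exists (d : 'rV[R]_n) (a : 'I_r -> R),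
  [/\ forall j, flat (A j) d, forall k, 0 <= a k, w = d + \sum_k a k *: row k
    & forall k j, 0 < a k -> {subset fmax (A j) w <= fmax (A j) (row k)}].
Hypothesis row_pos : forall k j, ~ flat (A j) (row k) ->
  (forall a, fmax (A j) (row k) <> [fset a]%fset) -> posdir (row k).

Variables (B : {fset 'rV[int]_n}) (B0 : B != fset0) (coe : 'rV[int]_n -> R).
Variable yf : 'rV[R]_n -> I -> int.
Hypothesis yf_ge0 : forall x j, 0 <= yf x j.
Hypothesis yf_typed : forall x, typed (pargmax coe B x) (yf x).

Lemma yf_expand x w : near0 (fun t => yf (x + t *: w) =1 faceL w (yf x)).
Proof.
apply: near0S (pmax_expand coe x w B0) => t t0 [e _].
apply: typed_uniq (yf_typed _) _; rewrite e.
by apply: typed_fmax (yf_typed x); rewrite pargmax_neq0.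
Qed.

Definition defect s x j : int := yf x j - mult s x j.

Lemma defect_expand s x w : near0 (fun t => defect s (x + t *: w) =1 faceL w (defect s x)).
Proof.
apply: near0S (near0_and (yf_expand x w) (mult_expand s x w)) => t _ [e1 e2] j.
by rewrite /defect e1 e2 /faceL -sumrB; apply: eq_bigr => i _; rewrite mulrBl.
Qed.

(** The unit to be subtracted has multiplicities [c (x - x0) i] at [x], and [dominate] bounds these
    by the defect there. *)
Lemma defect_add s i x0 : (forall x j, 0 <= defect s x j) -> 0 < defect s x0 i ->
  (forall j x, defect s x j != 0 -> (rk i <= rk j)%N) ->
  forall x j, 0 <= defect ((i, x0) :: s) x j.
Proof.
move=> ge0 d0 imin x j; rewrite /defect /mult big_cons /= opprD addrCA -/(mult s x j).
rewrite addrC subr_ge0.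
have := dominate ge0 (defect_expand s) imin row_cone row_pos (x - x0) j d0.
by rewrite addrCA subrr addr0.
Qed.

(* Finitely many points [wit M], one for each realised set [M] of maximal terms,
   suffice to detect that the defect decreases. *)
Definition wit M : 'rV[R]_n := xget 0 [set x | pargmax coe B x = M].

Definition defsum s : nat :=
  (\sum_(M <- fpowerset B) \sum_i `|defect s (wit M) i|)%N.

(** The point [wit M] has the same maximal terms as [x0], so their difference is flat on that cell
    and hence on its summand [A i]. The new unit therefore lowers the defect at [wit M] by one as
    well. *)
Lemma defsum_lt s i x0 : (forall x j, 0 <= defect s x j) ->
  (forall x j, 0 <= defect ((i, x0) :: s) x j) -> 0 < defect s x0 i ->
  (defsum ((i, x0) :: s) < defsum s)%N.
Proof.
move=> ge0 ge0' d0; pose M := pargmax coe B x0.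
have le x j : defect ((i, x0) :: s) x j <= defect s x j.
  by rewrite /defect /mult big_cons opprD addrA lerB // lerBlDr lerDl.
have lei x j : (`|defect ((i, x0) :: s) x j| <= `|defect s x j|)%N.
  by have := le x j; have := ge0' x j; lia.
have witM : pargmax coe B (wit M) = M.
  by rewrite /wit; have := @xgetPex _ 0 [set x | pargmax coe B x = M]; apply; exists x0.
have MB : M \in fpowerset B.
  by rewrite fpowersetE; apply/fsubsetP => a; apply: pargmax_sub.
have yfi : yf x0 i != 0.
  have : 0 <= mult s x0 i by apply: sumr_ge0.
  by move: d0; rewrite /defect; lia.
have fl : flat (A i) (wit M - x0).
  apply: (typed_flat (pargmax_neq0 coe x0 B0) (yf_ge0 x0) (yf_typed x0) yfi).
  rewrite -/M => a b aM bM; rewrite !dotBr.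
  have ea c' : c' \in M -> dot (intv R c') (wit M) - dot (intv R c') x0 =
      pmax coe B (wit M) - pmax coe B x0.
    move=> cM; have cM' : c' \in pargmax coe B (wit M) by rewrite witM.
    by rewrite (pmax_pargmax (cM : c' \in pargmax coe B x0)) (pmax_pargmax cM') /pterm; ring.
  by rewrite !ea.
have dM : defect s (wit M) i = defect ((i, x0) :: s) (wit M) i + 1.
  by rewrite /defect /mult big_cons /= c_flat // eqxx opprD addrA addrAC subrK.
rewrite /defsum -addn1 (big_fsetD1 M MB) [X in (_ <= X)%N](big_fsetD1 M MB) /=.
rewrite addnAC; apply: leq_add; last by apply: leq_sum => N _; apply: leq_sum.
rewrite (bigD1 i) //= [X in (_ <= X)%N](bigD1 i) //= addnAC; apply: leq_add.
  by have := ge0' (wit M) i; rewrite dM; lia.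
by apply: leq_sum.
Qed.

(** Repeatedly subtract a unit whose type has minimal rank among all nonzero defects at all points;
    [defsum] bounds the number of rounds. *)
Lemma decomposition : exists s, forall x j, defect s x j = 0.
Proof.
have [s0 ge0] : exists s, forall x j, 0 <= defect s x j.
  by exists [::] => x j; rewrite /defect /mult big_nil subr0.
have [N] := ubnP (defsum s0); elim: N s0 ge0 => // N IH s ge0 ltN.
have [z|nz] := pselect (forall x j, defect s x j = 0); first by exists s.
have ex : exists k, `[< exists i x, defect s x i != 0 /\ rk i = k >].
  apply: contrapT => nex; apply: nz => x j; apply: contrapT => /eqP d0; apply: nex.
  by exists (rk j); apply/asboolP; exists j, x.
case: (ex_minnP ex) => _ /asboolP[i [x0 [d0 <-]]] imin.
have d0' : 0 < defect s x0 i by rewrite lt_def d0 ge0.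
have imin' j x : defect s x j != 0 -> (rk i <= rk j)%N.
  by move=> dn0; apply: imin; apply/asboolP; exists j, x.
have ge0' := defect_add ge0 d0' imin'.
by apply: (IH _ ge0'); apply: leq_trans (defsum_lt ge0 ge0' d0') _.
Qed.

(** Once the defect vanishes, [pmax] and the sum of units have equal derivatives up to an integral
    linear form at every point, so [affine_of_near0] makes their difference affine. *)
Theorem unit_decomposition : exists s (k : R) (u : 'rV[int]_n),
  forall x, pmax coe B x = k + dot (intv R u) x + unitsum s x.
Proof.
have [s hs] := decomposition; exists s.
have loc x : exists v : 'rV[int]_n, forall w, near0 (fun t =>
    pmax coe B (x + t *: w) - unitsum s (x + t *: w) =
    pmax coe B x - unitsum s x + t * dot (intv R v) w).
  have [u hu] := unitsum_expand s x; have [u' hu'] := yf_typed x.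
  exists (u' - u) => w.
  apply: near0S (near0_and (hu w) (pmax_expand coe x w B0)) => t _ [-> [_ ->]].
  rewrite hu' intvB dotBl.
  have -> : \sum_i (yf x i)%:~R * h i w = \sum_j (mult s x j)%:~R * h j w.
    by apply: eq_bigr => j _; have /eqP := hs x j; rewrite subr_eq0 => /eqP->.
  ring.
have /choice[v hv] := loc.
have := @affine_of_near0 R n (fun x => pmax coe B x - unitsum s x) (fun x => intv R (v x)) hv.
move=> e; exists (pmax coe B 0 - unitsum s 0), (v 0) => x.
by rewrite -e subrK.
Qed.

End Decomposition.
End Types.

(* A point of [A] of maximal norm is the unique maximizer over [A] of its own
   scalar product, so the translation maps it to a point of [B]. *)
Lemma translation_integral (R : realType) (n : nat) (A B : {fset 'rV[int]_n})
    (x : 'rV[R]_n) : A != fset0 -> B != fset0 ->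
  (forall w, supf A w = dot x w + supf B w) -> exists u, x = intv R u.
Proof.
move=> A0 B0 e; have /fset0Pn[a1 a1A] := A0.
have [a aA amax] := @seq_argmin R _ (A : seq _)
  (fun a => - dot (intv R a) (intv R a)) a1 a1A.
have fa : fmax A (intv R a) = [fset a]%fset.
  have le b : b \in A -> b != a -> dot (intv R b) (intv R a) < dot (intv R a) (intv R a).
    move=> bA ba; have := amax b bA; rewrite lerN2.
    have : intv R b - intv R a != 0.
      by rewrite subr_eq0; apply: contraNneq ba => /intv_inj->.
    by move=> /dot_gt0; rewrite dotBr !dotBl [dot (intv R a) (intv R b)]dotC; lra.
  have aM : a \in fmax A (intv R a).
    apply/fmaxP; split=> // b bA; have [->//|ba] := eqVneq b a.
    exact/ltW/le.
  apply/fsetP => b; rewrite inE; apply/idP/eqP => [bM|->//].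
  apply/eqP; apply: contraT => /(le b (fmax_sub bM)).
  by rewrite -(supf_fmax bM) (supf_fmax aM) ltxx.
have /fset0Pn[b bM] := fmax_neq0 (intv R a) B0.
have ea := e (intv R a); rewrite (supf_fmax bM) (supf_fmax (a := a)) ?fa ?inE // in ea.
have ge z : dot x z + dot (intv R b) z <= dot (intv R a) z.
  have [t t0 [_]] := near0_ex (supf_expand (intv R a) z A0).
  have aM : a \in fmax A (intv R a) by rewrite fa inE.
  rewrite fa supf1 e (supf_fmax aM) ea dotDr dotZr => h.
  have := supf_ub (intv R a + t *: z) (fmax_sub bM); rewrite dotDr dotZr => h'.
  by rewrite -(ler_pM2l t0); move: h h'; rewrite mulrDr; lra.
exists (a - b); apply/eqP; rewrite -subr_eq0; apply/eqP/dot_all0 => z.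
rewrite dotC intvB dotBl dotBl.
by have := ge z; have := ge (- z); rewrite !dotNr; lra.
Qed.

(** Greedy choice, keeping an element only if it is related to none kept so far. It selects one
    polytope per class of lattice translates, as the basis condition concerns such classes. *)
Lemma representatives (T : eqType) (E : T -> T -> Prop) (s : seq T) :
  (forall x, E x x) -> (forall x y, E x y -> E y x) ->
  exists t, [/\ uniq t, {subset t <= s}, {in t &, forall x y, E x y -> x = y}
    & forall x, x \in s -> exists2 y, y \in t & E x y].
Proof.
move=> Er Es; elim: s => [|a s [t [ut ts tE tr]]]; first by exists [::].
have [[y yt ay]|na] := pselect (exists2 y, y \in t & E a y).
  exists t; split=> // [x xt|x]; first by rewrite inE ts ?orbT.
  by rewrite inE => /predU1P[->|/tr//]; exists y.
exists (a :: t); split.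
- by rewrite /= ut andbT; apply/negP => at_; apply: na; exists a.
- by move=> x; rewrite !inE => /predU1P[->|/ts->]; rewrite ?eqxx ?orbT.
- move=> x y; rewrite !inE => /predU1P[->|xt] /predU1P[->|yt] // exy; last exact: tE.
    by case: na; exists y.
  by case: na; exists x => //; apply: Es.
- move=> x; rewrite inE => /predU1P[->|/tr[y yt xy]].
    by exists a; rewrite ?mem_head.
  by exists y; rewrite // inE yt orbT.
Qed.

(** * Deriving the abstract hypotheses from a positive basis *)

Section PositiveBasis.
Variables (R : realType) (n : nat) (S : {fset set 'rV[R]_n}).
Implicit Types (P Q : set 'rV[R]_n) (d v w z : 'rV[R]_n).
Notation pts A := [set intv R a | a in [set` A]].

Variable V : set 'rV[R]_n -> {fset 'rV[int]_n}.
Hypothesis V0 : forall P, P \in S -> V P != fset0.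
Hypothesis VE : forall P, P \in S -> P = conv (pts (V P)).

(** Transfers the trichotomy of whole polytope, vertex and proper face to generating points: a face
    equal to [P] has the same support function, which forces zero width along [v]. *)
Lemma face_cases P v : P \in S -> [\/ flat (V P) v,
  exists a, fmax (V P) v = [fset a]%fset | proper_face P (face v P)].
Proof.
move=> PS; have [f|nf] := pselect (flat (V P) v); first exact: Or31.
have [s|ns] := pselect (exists a, fmax (V P) v = [fset a]%fset); first exact: Or32.
have A0 := V0 PS; have M0 := fmax_neq0 v A0.
apply: Or33; have eF : face v P = conv (pts (fmax (V P) v)).
  by rewrite {1}(VE PS) conv_pts_face.
split; first by exists v.
  rewrite eF => e; apply: nf.
  have eh : @supf R n (fmax (V P) v) =1 supf (V P).
    have hM := @is_supf_conv R n _ M0; have hP := @is_supf_conv R n _ A0.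
    by rewrite e in hM; rewrite -(VE PS) in hP; apply: is_supf_uniq hM hP.
  by apply/flatE => //; rewrite -!eh; apply/flatE => //; apply: flat_fmax.
move=> x; rewrite eF => e; apply: ns; have /fset0Pn[a aM] := M0; exists a.
have ex b : b \in fmax (V P) v -> intv R b = x.
  move=> bM; have : conv (pts (fmax (V P) v)) (intv R b) by apply: sub_conv; exists b.
  by rewrite e.
apply/fsetP => b; rewrite inE; apply/idP/eqP => [bM|->//].
by apply: (@intv_inj R); rewrite !ex.
Qed.

Lemma NS_supf B : B != fset0 -> NS S (conv (pts B)) ->
  exists (u : 'rV[int]_n) (y : set 'rV[R]_n -> nat), forall z,
    supf B z = dot (intv R u) z + \sum_(P <- S) (y P)%:R * supf (V P) z.
Proof.
move=> B0 [_ [y [u e]]]; exists u, y; apply: is_supf_uniq (@is_supf_conv R n _ B0) _.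
rewrite e; apply: is_supf_translate; apply: is_supf_minksum => P PS.
by rewrite {1}(VE PS); apply: is_supf_conv; apply: V0.
Qed.

Variable T : {fset 'rV[int]_n}.
Hypothesis T0 : T != fset0.
Hypothesis TE : Defs.total S = conv (pts T).

Lemma supfT z : supf T z = dot 0 z + \sum_(P <- S) 1 * supf (V P) z.
Proof.
have hV P : P \in S -> is_supf P (supf (V P)).
  by move=> PS; rewrite {1}(VE PS); apply: is_supf_conv; apply: V0.
have hT := @is_supf_conv R n T T0; rewrite -TE in hT.
by rewrite dot0l add0r (is_supf_uniq hT (is_supf_minksum (fun=> 1%N) hV)).
Qed.

Lemma flatT d : flat T d <-> forall P, P \in S -> flat (V P) d.
Proof.
rewrite (supf_comb_flat V0 T0 supfT) //.
by split=> f P PS; [apply: f; rewrite ?oner_eq0|move=> _; apply: f].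
Qed.

Lemma supf_fmaxT w z :
  supf (fmax T w) z = dot 0 z + \sum_(P <- S) 1 * supf (fmax (V P) w) z.
Proof. exact: (supf_comb_fmax V0 T0 supfT). Qed.

Lemma flat_fmaxT w d : flat (fmax T w) d <-> forall P, P \in S -> flat (fmax (V P) w) d.
Proof.
have M0 := fmax_neq0 w T0.
have VM0 P : P \in S -> fmax (V P) w != fset0 by move=> PS; rewrite fmax_neq0 ?V0.
rewrite (supf_comb_flat VM0 M0 (supf_fmaxT w)) //.
by split=> f P PS; [apply: f; rewrite ?oner_eq0|move=> _; apply: f].
Qed.

(** The loss in maximizing [v] only over the face in direction [w] is the sum of the losses of the
    summands. Each is nonnegative and the total is zero. *)
Lemma fmax_subT w v P : (fmax T w `<=` fmax T v)%fset -> P \in S ->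
  {subset fmax (V P) w <= fmax (V P) v}.
Proof.
move=> /fsubsetP sub PS.
have M0 := fmax_neq0 w T0; have /fset0Pn[m mM] := M0.
have fT : flat (fmax T w) v.
  by move=> a b /sub av /sub bv; rewrite -(supf_fmax av) -(supf_fmax bv).
have fP := (flat_fmaxT w v).1 fT.
have eT : supf (fmax T w) v = supf T v.
  rewrite (supf_fmax (sub m mM)) (supf_fmax (a := m)) //.
  by rewrite flat_fmaxE.
have le Q : Q \in S -> supf (fmax (V Q) w) v <= supf (V Q) v.
  move=> QS; have [a aM ->] := supf_ex v (fmax_neq0 w (V0 QS)).
  exact/supf_ub/fmax_sub/aM.
have : \sum_(Q <- S) (supf (V Q) v - supf (fmax (V Q) w) v) = 0.
  have := eT; rewrite supf_fmaxT supfT => /addrI e1.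
  rewrite sumrB; apply/eqP; rewrite subr_eq0; apply/eqP.
  transitivity (\sum_(Q <- S) 1 * supf (V Q) v); first by apply: eq_bigr => Q _; rewrite mul1r.
  by rewrite -e1; apply: eq_bigr => Q _; rewrite mul1r.
move/eqP; rewrite big_seq psumr_eq0 => [/allP/(_ P PS)|Q QS]; last by rewrite subr_ge0 le.
rewrite PS /= subr_eq0 => /eqP eP a aM; rewrite mem_fmax (fmax_sub aM) eP /=.
have aMv : a \in fmax (fmax (V P) w) v by rewrite flat_fmaxE //; apply: fP.
by rewrite (supf_fmax aMv).
Qed.

Variables (r : nat) (H : 'M[int]_(r, n)).
Hypothesis HT : is_Hmatrix H (Defs.total S).

Notation vrow k := (intv R (row k H)).

Lemma row_facet k : facet_normal (conv (pts T)) (row k H).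
Proof. by rewrite -TE; apply/HT.2; exists k. Qed.

Lemma row_dirspace k : vrow k \in dirspace (conv (pts T)).
Proof. by case: (row_facet k). Qed.

Lemma row_cone_total w : exists (d : 'rV[R]_n) (a : 'I_r -> R),
  [/\ flat T d, forall k, 0 <= a k, w = d + \sum_k a k *: vrow k
    & forall k P, 0 < a k -> P \in S -> {subset fmax (V P) w <= fmax (V P) (vrow k)}].
Proof.
have [u uU hu] := ortho_decomp (dirspace (conv (pts T))) w.
have fd : flat T (w - u) by apply: ortho_flat.
have HT' : is_Hmatrix H (conv (pts T)) by rewrite -TE.
have [a [a0 eu sub]] := normal_cone T0 HT' uU.
exists (w - u), a; split=> //; first by rewrite -eu subrK.
move=> k P ak PS; have -> : fmax (V P) w = fmax (V P) u.
  have fP := (flatT _).1 fd P PS.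
  by rewrite -[in LHS](subrK u w) addrC fmax_flatD.
exact: fmax_subT (sub k ak) PS.
Qed.

Hypothesis hier : hierarchical S.

(** By hierarchy a proper face of [P] in direction [v] is a sum of members of [S] flat along [v];
    each of these coincides with its own face in direction [-v]. *)
Lemma flat_face_opp v d P : P \in S ->
  (forall Q, Q \in S -> flat (fmax (V Q) (- v)) d) -> flat (fmax (V P) v) d.
Proof.
move=> PS fopp; case: (face_cases v PS) => [f|[a ->]|pf].
- by have := fopp P PS; rewrite !flat_fmaxE //; apply: flatN.
- by move=> b b'; rewrite !inE => /eqP-> /eqP->.
have M0 := fmax_neq0 v (V0 PS).
have := hier PS pf; rewrite {1}(VE PS) conv_pts_face ?V0 // => /(NS_supf M0)[u [y e]].
have y0 Q : Q \in (S : seq _) -> 0 <= (y Q)%:R :> R by [].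
apply/(supf_comb_flat V0 M0 e _ y0) => Q QS yQ.
have fv := (supf_comb_flat V0 M0 e v y0).1 (@flat_fmax _ _ _ v) Q QS yQ.
by have := fopp Q QS; rewrite flat_fmaxE //; apply: flatN.
Qed.

(** By [flat_face_opp], directions flat on the face opposite to a facet are flat on the facet, so
    the opposite face has a direction space at least as large and is a facet too. *)
Lemma row_opp k : exists k', row k' H = - row k H.
Proof.
have [g vU h] := (facetP R T0 _).1 (row_facet k).
apply/HT.2; rewrite TE; apply/facetP => //; split; rewrite ?intvN.
- rewrite -g; elim: (index_enum _) => [|i s IH]; rewrite ?big_nil // !big_cons IH mxE.
  by rewrite gcdNz.
- by rewrite rpredN.
- move=> z zU /eqP; rewrite dotNl oppr_eq0 => /eqP vz.
  apply/mem_dirspace; first exact: fmax_neq0.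
  move=> d /flat_fmaxT fd; have /mem_dirspace := h z zU vz; apply; first exact: fmax_neq0.
  by apply/flat_fmaxT => P PS; apply: flat_face_opp.
Qed.

Lemma bvec_ex P : exists b : 'rV[int]_r, P \in S -> forall k, (b 0 k)%:~R = supf (V P) (vrow k).
Proof.
have [PS|nPS] := boolP (P \in S); last by exists 0.
have /choice[b hb] : forall k, exists m : int, m%:~R = supf (V P) (vrow k).
  by move=> k; have [a aA ->] := supf_ex (vrow k) (V0 PS); rewrite dot_intv; eexists.
by exists (\row_k b k) => _ k; rewrite mxE.
Qed.

Variable bv : set 'rV[R]_n -> 'rV[int]_r.
Hypothesis bvE : forall P, P \in S -> forall k, (bv P 0 k)%:~R = supf (V P) (vrow k).

Lemma flatT_ortho d z : flat T d -> z \in dirspace (conv (pts T)) -> dot d z = 0.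
Proof. by move=> fd /(mem_dirspace _ T0); apply. Qed.

(** A support function is linear on each normal cone, so its values at the facet normals and on the
    lineality space determine it. *)
Lemma supf_cone P p w d (a : 'I_r -> R) : P \in S -> p \in V P -> flat T d ->
  w = d + \sum_k a k *: vrow k -> (forall k, 0 <= a k) ->
  (forall k, 0 < a k -> {subset fmax (V P) w <= fmax (V P) (vrow k)}) ->
  supf (V P) w = dot (intv R p) d + \sum_k a k * supf (V P) (vrow k).
Proof.
move=> PS pP fd ew a0 sub; have /fset0Pn[m mM] := fmax_neq0 w (V0 PS).
rewrite (supf_fmax mM) {1}ew dotDr dot_sumr; congr (_ + _).
  by apply: ((flatT d).1 fd P PS) => //; apply: fmax_sub mM.
apply: eq_bigr => k _; rewrite dotZr.
have := a0 k; rewrite le_eqVlt => /predU1P[<-|ak]; first by rewrite !mul0r.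
by rewrite (supf_fmax (sub k ak m mM)).
Qed.

(** By [supf_cone] the inequalities at the facet normals imply those in all directions. Each bound
    is attained on [P], hence minimal. *)
Lemma bv_is_bvec P : P \in S -> is_bvec H (Defs.total S) P (bv P).
Proof.
move=> PS; rewrite TE; split.
  apply/seteqP; split=> x.
    move=> Px; split; first by exists x; rewrite // subrr mem0v.
    move=> k; rewrite bvE //; move: Px; rewrite {1}(VE PS) => /(convP _ (V0 PS)); apply.
  move=> [[q Pq xq] hx]; rewrite {1}(VE PS); apply/(convP _ (V0 PS)) => w.
  have [d [a [fd a0 ew sub]]] := row_cone_total w.
  have /fset0Pn[p pP] := V0 PS.
  rewrite (supf_cone PS pP fd ew a0) => [|k ak]; last exact: sub.
  rewrite {1}ew dotDl dot_suml; apply: lerD.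
    have -> : dot d x = dot d q.
      by apply/eqP; rewrite -subr_eq0 -dotBr; apply/eqP/flatT_ortho.
    have fP := (flatT d).1 fd P PS.
    have : conv (pts (V P)) q by rewrite -(VE PS).
    move=> /(convP _ (V0 PS)) /(_ d) /le_trans; apply.
    by rewrite -[d]add0r (supf_flatD _ pP fP) supf0 ?V0 // !add0r.
  apply: ler_sum => k _; rewrite dotZl ler_wpM2l // -bvE //.
move=> b' e k; rewrite -(ler_int R) bvE //.
have [a aP ->] := supf_ex (vrow k) (V0 PS).
have : P (intv R a) by rewrite {1}(VE PS); apply: sub_conv; exists a.
by rewrite dotC {1}e => -[_]; apply.
Qed.

Definition transl P Q := exists u : 'rV[int]_n, forall z,
  supf (V P) z = dot (intv R u) z + supf (V Q) z.

Lemma transl_refl P : transl P P.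
Proof. by exists 0 => z; rewrite intv0 dot0l add0r. Qed.

Lemma transl_sym P Q : transl P Q -> transl Q P.
Proof. by move=> [u e]; exists (- u) => z; rewrite intvN dotNl e addKr. Qed.

(** The support functions differ by [u] on facet normals; [e2], orthogonal to the direction space of
    the total polytope, corrects the difference on its lineality space. The real translation so
    obtained is integral by [translation_integral]. *)
Lemma bv_transl P Q : P \in S -> Q \in S ->
  translations H (bv P - bv Q) -> transl P Q.
Proof.
move=> PS QS [u _ eu].
have /fset0Pn[p pP] := V0 PS; have /fset0Pn[q qQ] := V0 QS.
have [e1 e1U he] := ortho_decomp (dirspace (conv (pts T))) (intv R (p - q - u)).
set e2 := _ - e1 in he.
suff e w : supf (V P) w = dot (intv R u + e2) w + supf (V Q) w.
  have [v ev] := translation_integral (V0 PS) (V0 QS) e.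
  by exists v => z; rewrite e ev.
have [d [a [fd a0 ew sub]]] := row_cone_total w.
rewrite (supf_cone PS pP fd ew a0) => [|k ak]; last exact: sub.
rewrite (supf_cone QS qQ fd ew a0) => [|k ak]; last exact: sub.
have hk k : supf (V P) (vrow k) = supf (V Q) (vrow k) + dot (intv R u) (vrow k).
  rewrite -!bvE // -[bv P](subrK (bv Q)) -eu mxE rmorphD /= addrC; congr (_ + _).
  by rewrite dot_intv mxE; congr (_%:~R); apply: eq_bigr => i _; rewrite !mxE.
under eq_bigr do rewrite hk mulrDr.
rewrite big_split /=.
have -> : \sum_k a k * dot (intv R u) (vrow k) = dot (intv R u) w - dot (intv R u) d.
  rewrite {1}ew dotDr addrAC subrr add0r dot_sumr.
  by apply: eq_bigr => k _; rewrite dotZr.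
have e2w : dot e2 w = dot d (intv R (p - q - u)).
  rewrite -[intv R (p - q - u)](subrK e1) -/e2 dotDr (flatT_ortho fd e1U) addr0.
  rewrite dotC {1}ew dotDl dot_suml big1 ?addr0 // => k _.
  by rewrite dotZl he ?mulr0 // row_dirspace.
move: e2w; rewrite dotDl !intvB !dotBr ![dot d _]dotC => ->.
ring.
Qed.

Hypothesis basis : is_basis H S.

Variable s : seq (set 'rV[R]_n).
Hypotheses (us : uniq s) (sS : {subset s <= S}).
Hypothesis sE : {in s &, forall P Q, transl P Q -> P = Q}.

Notation I := 'I_(size s).
Definition rep_points (i : I) := V (tnth (in_tuple s) i).
Notation A := rep_points.

Lemma tnths i : tnth (in_tuple s) i \in s.
Proof. exact: (mem_tnth i (in_tuple s)). Qed.

Lemma tnthS i : tnth (in_tuple s) i \in S.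
Proof. exact/sS/tnths. Qed.

Lemma A_neq0 i : A i != fset0.
Proof. exact/V0/tnthS. Qed.

Lemma bv_inj : {in s &, injective bv}.
Proof.
move=> P Q Ps Qs e; apply: sE => //; apply: bv_transl; rewrite ?sS //.
by exists 0 => //; rewrite mul0mx e subrr.
Qed.

(** Evaluating the relation at the facet normals yields a relation between the b-vectors modulo
    translations, to which the basis hypothesis applies. *)
Lemma reps_indep (u : 'rV[int]_n) (y : I -> int) :
  (forall z, dot (intv R u) z + \sum_i (y i)%:~R * supf (A i) z = 0) -> forall i, y i = 0.
Proof.
move=> e.
(* [zbasis_mod] indexes coefficients by vectors; by [bv_inj] each of these sums over a vector of the
   family has one term. *)
pose y' b := \sum_(i < size s | bv (tnth (in_tuple s) i) == b) y i.
have y'E i : y' (bv (tnth (in_tuple s) i)) = y i.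
  rewrite /y' (bigD1 i) //= big1 ?addr0 // => j /andP[/eqP ej ji].
  case/negP: ji; apply/eqP/val_inj/eqP; move: ej.
  move/(bv_inj (tnths _) (tnths _)); rewrite !(tnth_nth set0) => /eqP.
  by rewrite nth_uniq.
move=> i; rewrite -y'E; apply: (basis (s := map bv s)).
- by rewrite map_inj_in_uniq //; apply: bv_inj.
- by move=> _ /mapP[P Ps ->]; exists P; [apply: sS|apply/bv_is_bvec/sS].
- move=> _ _ /mapP[P Ps ->] /mapP[Q Qs ->] /(bv_transl (sS Ps) (sS Qs)) t.
  by rewrite (sE Ps Qs t).
- exists (- u) => //; rewrite big_map big_tnth; apply/rowP => k.
  apply: (@intr_inj R); rewrite summxE.
  have := e (vrow k) => /eqP; rewrite addr_eq0 => /eqP ek.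
  transitivity (- dot (intv R u) (vrow k)).
    by rewrite mulNmx mxE intrN dot_intv mxE; congr (- _%:~R); apply: eq_bigr => j _; rewrite !mxE.
  rewrite ek opprK rmorph_sum; apply: eq_bigr => j _.
  rewrite y'E /rep_points -bvE ?tnthS // -intrM; congr (_%:~R).
  by rewrite -scaler_int mxE intz.
- by apply: map_f; apply: tnths.
Qed.

Hypothesis sR : forall P, P \in S -> exists2 Q, Q \in s & transl P Q.

Lemma rep_index P : P \in S -> exists (i : I) (u : 'rV[int]_n), forall z,
  supf (V P) z = dot (intv R u) z + supf (A i) z.
Proof.
move=> PS; have [Q Qs [u e]] := sR PS.
have ltQ : (index Q s < size s)%N by rewrite index_mem.
exists (Ordinal ltQ), u => z; rewrite e /rep_points (tnth_nth set0) /= nth_index //.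
Qed.

Lemma NS_typed B : B != fset0 -> NS S (conv (pts B)) ->
  exists y : I -> int, (forall i, 0 <= y i) /\ typed R A B y.
Proof.
move=> B0 /(NS_supf B0)[u [k e]].
(* This class is closed under sums and natural multiples and contains every [supf (V P)]; passing to
   representatives merges the multiplicities of translates. *)
pose tf (g : 'rV[R]_n -> R) := exists (v : 'rV[int]_n) (y : I -> int),
  (forall i, 0 <= y i) /\ forall z, g z = dot (intv R v) z + \sum_i (y i)%:~R * supf (A i) z.
have tf0 : tf (fun=> 0).
  by exists 0, (fun=> 0); split=> // z; rewrite intv0 dot0l add0r big1 // => i _; rewrite mul0r.
have tfD g g' : tf g -> tf g' -> tf (fun z => g z + g' z).
  move=> [v [y [y0 eg]]] [v' [y' [y'0 eg']]]; exists (v + v'), (fun i => y i + y' i).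
  split=> [i|z]; first by rewrite addr_ge0.
  rewrite eg eg' intvD dotDl; under [X in _ = _ + X]eq_bigr do rewrite intrD mulrDl.
  by rewrite big_split addrACA.
have tfM m g : tf g -> tf (fun z => m%:R * g z).
  move=> tg; elim: m => [|m IH]; first by congr tf: tf0; apply/funext => z; rewrite mul0r.
  by congr tf: (tfD _ _ tg IH); apply/funext => z; rewrite -natr1 mulrDl mul1r addrC.
have tfV P : P \in S -> tf (supf (V P)).
  move=> /rep_index[i [v ev]]; exists v, (fun j => (i == j)%:Z); split=> // z.
  rewrite ev (bigD1 i) //= eqxx mul1r big1 ?addr0 // => j.
  by rewrite eq_sym => /negbTE->; rewrite mul0r.
have tfS (l : seq (set 'rV[R]_n)) : {subset l <= S} ->
    tf (fun z => \sum_(P <- l) (k P)%:R * supf (V P) z).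
  elim: l => [_|P l IH sub]; first by congr tf: tf0; apply/funext => z; rewrite big_nil.
  have tP : tf (supf (V P)) by apply: tfV; apply: sub; rewrite mem_head.
  have tl := IH (fun Q Ql => sub Q (mem_behead (s := P :: l) Ql)).
  by congr tf: (tfD _ _ (tfM (k P) _ tP) tl); apply/funext => z; rewrite big_cons.
have [v [y [y0 eg]]] := tfS S (fun _ => id).
exists y; split=> //; exists (u + v) => z.
by rewrite e eg intvD dotDl addrA.
Qed.

Lemma face_typed w i :
  exists y : I -> int, (forall j, 0 <= y j) /\ typed R A (fmax (A i) w) y.
Proof.
case: (face_cases w (tnthS i)) => [f|[a ea]|pf].
- rewrite flat_fmaxE //; exists (fun j => (i == j)%:Z); split=> //; exact: typed_self.
- by rewrite /rep_points ea; exists (fun=> 0); split=> //; apply: typed_point.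
- have := hier (tnthS i) pf; rewrite {1}(VE (tnthS i)) conv_pts_face ?V0 ?tnthS //.
  by apply: NS_typed; rewrite fmax_neq0 // A_neq0.
Qed.

Variable tau : 'rV[int]_n -> int.
Hypotheses (tauO : orientation H tau) (tauP : positive H tau S).

(** A proper face in direction [row k] forces orientation +1: otherwise the opposite row has
    orientation +1, and positivity for it forbids that proper face. Positivity for [row k] itself
    then gives [posdir]. *)
Lemma row_posdir k i : ~ flat (A i) (vrow k) ->
  (forall a, fmax (A i) (vrow k) <> [fset a]%fset) -> posdir A (vrow k).
Proof.
move=> nf ns; have pf : proper_face (tnth (in_tuple s) i) (face (vrow k) (tnth (in_tuple s) i)).
  by case: (face_cases (vrow k) (tnthS i)) => // -[a /ns].
have tk : tau (row k H) = 1.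
  have [[//|tn] tN] := tauO k; have [k' ek'] := row_opp k.
  have t1 : tau (row k' H) = 1 by rewrite ek' tN tn opprK.
  by case: (tauP t1 (tnthS i)); rewrite ek' intvN opprK.
move=> j; have := tauP tk (tnthS j); case: (face_cases (- vrow k) (tnthS j)) => [f _|sg _|//].
  by left; rewrite -[vrow k]opprK; apply: flatN.
by right.
Qed.

Lemma row_cone_reps w : exists (d : 'rV[R]_n) (a : 'I_r -> R),
  [/\ forall j, flat (A j) d, forall k, 0 <= a k, w = d + \sum_k a k *: vrow k
    & forall k j, 0 < a k -> {subset fmax (A j) w <= fmax (A j) (vrow k)}].
Proof.
have [d [a [fd a0 ew sub]]] := row_cone_total w; exists d, a; split=> //.
  by move=> j; apply: (flatT d).1 fd _ (tnthS j).
by move=> k j ak; apply: sub (tnthS j).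
Qed.

(** In the trivial subdivision the whole Newton polytope is a cell, dual to some [p]: the terms
    maximal at [p] already span it, so [f] is its support function centred at [p]. *)
Lemma unit_form (f : tpoly R n) : is_unit f -> exists (p : 'rV[R]_n) (c : R),
  forall x, teval f x = c + supf (supp f) (x - p).
Proof.
move=> fu; have N0 := supp_neq0 f.
have : Delta f (Newt f).
  rewrite fu; exists 0; rewrite /Newt conv_pts_face // flat_fmaxE //; exact: flat0.
move=> /DeltaP[p eN].
have M0 := pargmax_neq0 (coef f) p N0.
have e : @supf R n (supp f) =1 supf (pargmax (coef f) (supp f) p).
  have hN := @is_supf_conv R n _ N0; have hM := @is_supf_conv R n _ M0.
  by rewrite -eN in hM; apply: is_supf_uniq hN hM.
exists p, (pmax (coef f) (supp f) p) => x.
have [a aM ea] := supf_ex (x - p) M0.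
have tE b : pterm (coef f) x b = pterm (coef f) p b + dot (intv R b) (x - p).
  by rewrite /pterm dotBr; ring.
rewrite e ea (pmax_pargmax aM) -tE; apply: pmaxP (pargmax_sub aM) _ => b bS.
by rewrite !tE lerD // -?(pmax_pargmax aM) ?pmax_ub // -ea -e supf_ub.
Qed.

Lemma Sunit_form (f : tpoly R n) : is_Sunit S f ->
  exists (q : I * 'rV[R]_n) (c : R) (u : 'rV[int]_n),
    forall x, teval f x = c + dot (intv R u) x + supf (A q.1) (x - q.2).
Proof.
move=> [/unit_form[p [c e]] [P PS [v eN]]].
have [i [u ei]] := rep_index PS.
have eS : @supf R n (supp f) =1 (fun z => dot (intv R v) z + supf (V P) z).
  have := @is_supf_conv R n _ (supp_neq0 f); rewrite -/(Newt f) eN => hN.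
  apply: is_supf_uniq hN _; apply: is_supf_translate.
  by rewrite {1}(VE PS); apply: is_supf_conv; apply: V0.
exists (i, p), (c - dot (intv R (v + u)) p), (v + u) => x.
by rewrite e eS ei /= intvD !dotBr !dotDl; ring.
Qed.

(** The coefficients make every term equal to the scalar product of its exponent with [x - q.2], so
    this is the support function with apex [q.2]. *)
Definition mkunit (q : I * 'rV[R]_n) : tpoly R n :=
  TPoly (A_neq0 q.1) (fun a => - dot (intv R a) q.2).

Lemma mkunit_term q x : pterm (coef (mkunit q)) x =1 pterm (fun=> 0) (x - q.2).
Proof. by move=> a; rewrite /pterm /= dotBr; ring. Qed.

Lemma teval_mkunit q x : teval (mkunit q) x = supf (A q.1) (x - q.2).
Proof.
have [a aA ea] := pmax_ex (coef (mkunit q)) x (A_neq0 q.1).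
rewrite [LHS]ea mkunit_term; apply/esym/pmaxP => // b bA.
by rewrite -!mkunit_term -ea pmax_ub.
Qed.

Lemma pargmax_mkunit q x :
  pargmax (coef (mkunit q)) (supp (mkunit q)) x = fmax (A q.1) (x - q.2).
Proof.
apply/fsetP => a; rewrite mem_fmax mem_pargmax mkunit_term pterm0; congr (_ && (_ == _)).
exact: teval_mkunit.
Qed.

Lemma mkunit_Sunit q : is_Sunit S (mkunit q).
Proof.
have NE : Newt (mkunit q) = tnth (in_tuple s) q.1 by rewrite [RHS](VE (tnthS q.1)).
split; last first.
  exists (tnth (in_tuple s) q.1); first exact: tnthS.
  exists 0; rewrite NE; apply/seteqP; split=> [x Px|_ [x Px <-]].
    by exists x => //; rewrite intv0 add0r.
  by rewrite intv0 add0r.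
apply/seteqP; split=> F.
  move=> /DeltaP[x ->]; exists (x - q.2); rewrite pargmax_mkunit.
  by rewrite /Newt conv_pts_face // A_neq0.
move=> [v ->]; apply/DeltaP; exists (v + q.2); rewrite pargmax_mkunit addrK.
by rewrite /Newt conv_pts_face // A_neq0.
Qed.

Lemma local_fact : local_factorization S.
Proof.
move=> f cells.
have /choice[c hc] : forall wi : 'rV[R]_n * I, exists y : I -> int,
    (forall j, 0 <= y j) /\ typed R A (fmax (A wi.2) wi.1) y.
  by move=> [w i]; apply: face_typed.
have /choice[yf hyf] : forall x, exists y : I -> int,
    (forall j, 0 <= y j) /\ typed R A (pargmax (coef f) (supp f) x) y.
  move=> x; apply: NS_typed; first exact/pargmax_neq0/supp_neq0.
  by apply: cells; apply/DeltaP; exists x.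
have [t [k [u e]]] := unit_decomposition A_neq0 reps_indep
  (c := fun w i => c (w, i)) (fun w i => (hc (w, i)).1) (fun w i => (hc (w, i)).2)
  row_cone_reps row_posdir (supp_neq0 f) (fun x => (hyf x).1) (fun x => (hyf x).2).
exists (size t), (fun i => mkunit (tnth (in_tuple t) i)); split.
  by move=> i; apply: mkunit_Sunit.
exists k, u => x; rewrite [LHS]e; congr (_ + _); rewrite /unitsum big_tnth.
by apply: eq_bigr => i _; rewrite teval_mkunit.
Qed.

(** Write both products as sums of units with types and apexes; their keys agree as multisets by
    [keys_uniq], and the matching permutation pairs units that are equal as tropical polynomials. *)
Lemma unique_fact : unique_factorization S.
Proof.
move=> f k l uu ww [uS [ku [vu eu]]] [wS [kw [vw ew]]].
have /choice[c hc] : forall wi : 'rV[R]_n * I, exists y : I -> int,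
    (forall j, 0 <= y j) /\ typed R A (fmax (A wi.2) wi.1) y.
  by move=> [w i]; apply: face_typed.
have /choice[gu hgu] := fun i => Sunit_form (uS i).
have /choice[gw hgw] := fun i => Sunit_form (wS i).
have sum_form m (g : 'I_m -> I * 'rV[R]_n) (z : 'I_m -> tpoly R n) :
    (forall i, exists (c : R) (u : 'rV[int]_n), forall x,
      teval (z i) x = c + dot (intv R u) x + supf (A (g i).1) (x - (g i).2)) ->
    exists (c : R) (u : 'rV[int]_n), forall x,
      \sum_i teval (z i) x = c + dot (intv R u) x + unitsum A (map g (enum 'I_m)) x.
  move=> /choice[kk] /choice[vv hv]; exists (\sum_i kk i), (\sum_i vv i) => x.
  rewrite intv_sum dot_suml /unitsum big_map big_enum -!big_split.
  by apply: eq_bigr => i _; rewrite hv.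
have [c1 [v1 e1]] := sum_form _ _ _ hgu; have [c2 [v2 e2]] := sum_form _ _ _ hgw.
have pk : perm_eq (map (key A) (map gu (enum 'I_k))) (map (key A) (map gw (enum 'I_l))).
  apply: (keys_uniq A_neq0 reps_indep (c := fun w i => c (w, i))
    (fun w i => (hc (w, i)).1) (fun w i => (hc (w, i)).2)).
  apply: (mult_uniq A_neq0 reps_indep (c := fun w i => c (w, i)) (fun w i => (hc (w, i)).2)).
  exists (kw + c2 - (ku + c1)), (vw + v2 - (vu + v1)) => x.
  have := eu x; rewrite ew e1 e2 intvB !intvD dotBl !dotDl; lra.
have ekl : k = l by have := perm_size pk; do !rewrite (size_map (key A)) size_map size_enum_ord.
subst l.
have tE (g : 'I_k -> I * 'rV[R]_n) :
    [tuple key A (g i) | i < k] = map (key A) (map g (enum 'I_k)) :> seq _.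
  by rewrite -map_comp.
have /tuple_permP[p ep] : perm_eq [tuple key A (gu i) | i < k] [tuple key A (gw i) | i < k].
  by rewrite !tE.
exists p; first exact: injF_bij perm_inj.
move=> i; have ek : key A (gu i) = key A (gw (p i)).
  have := congr1 (fun t : seq _ => nth (key A (gu i)) t i) ep.
  rewrite -!(tnth_nth _ _ i) !tnth_mktuple //.
have [cu [vu' hu]] := hgu i; have [cw [vw' hw]] := hgw (p i).
have [e12 fl] := (eq_key _ _ _).1 ek.
have /fset0Pn[a aA] := A_neq0 (gu i).1.
(* The two apexes differ by a vector flat on the polytope, so moving the apex changes the support
   function by the constant [dot (intv R a)] of that vector. *)
exists (cu - cw + dot (intv R a) ((gw (p i)).2 - (gu i).2)), (vu' - vw') => x.
rewrite hu hw -e12.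
have -> : x - (gu i).2 = x - (gw (p i)).2 + ((gw (p i)).2 - (gu i).2).
  by rewrite addrA subrK.
rewrite (supf_flatD _ aA) ?intvB ?dotBl; last by rewrite -opprB; apply: flatN.
ring.
Qed.

End PositiveBasis.

Theorem theorem1 (R : realType) (n : nat) (S : {fset set 'rV[R]_n})
    (latS : forall P : set 'rV[R]_n, P \in S -> lattice_polytope P)
    (posS : positive_basis S) :
  unique_factorization S /\ local_factorization S.
Proof.
have [r [H [HT hier basis [tau tauO tauP]]]] := posS.
have /choice[V hV] : forall P : set 'rV[R]_n, exists A : {fset 'rV[int]_n},
    P \in S -> A != fset0 /\ P = conv [set intv R a | a in [set` A]].
  (* The empty set is a default value for sets outside [S]. *)
  move=> P; have [PS|nPS] := boolP (P \in S); last by exists fset0.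
  by have [A A0 e] := latS P PS; exists A.
have V0 P (PS : P \in S) := (hV P PS).1.
have VE P (PS : P \in S) := (hV P PS).2.
have [T T0 TE] := total_lattice latS.
have /choice[bv bvE] := bvec_ex V0 H.
have [s [us sS sE sR]] := representatives S (transl_refl V) (@transl_sym _ _ V).
split.
  exact: (unique_fact V0 VE T0 TE HT hier bvE basis us sS sE sR).
exact: (local_fact V0 VE T0 TE HT hier bvE basis us sS sE sR tauO tauP).
Qed.
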